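(* Consider the system $\dot x=\sum_{k=1}^mf_k(x)u_k$ on a domain $D\subseteq\mathbb R^n$ with $f_k\in C^2(D;\mathbb R^n)$ satisfying Assumption 2 formulated in the context, and a point $x^*\in D$. Let $P\in C^2(D;\mathbb R)$, with lower bound $m_P\in\mathbb R$, satisfy the following conditions: 1) there exist functions $w_{11},w_{12}\in\mathcal K$ such that $\{x\in\mathbb R^n:\|x-x^*\|\le w_{11}^{-1}(P(x^0)-m_P)\}\subset D$ for all $x^0\in D$, and $w_{11}(\|x-x^*\|)\le P(x)-m_P\le w_{12}(\|x-x^*\|)$ for all $x\in D$; 2) $\|\nabla P(x)\|=0$ if and only if $x=x^*$, and there exists a function $w_2\in\mathcal K$ such that $\|\nabla P(x)\|\le w_2(\|x-x^*\|)$ for all $x\in D$. Then for any $\gamma>0$ there exists an $\bar\varepsilon>0$ such that, for any $\varepsilon\in(0,\bar\varepsilon)$, the point $x^*$ is asymptotically stable for the system with the controls $u_k=u_k^\varepsilon(a(x),t)$ (defined in the context from $P,\gamma,\varepsilon$), where the solutions of the closed-loop system are understood as $\pi_\varepsilon$-solutions.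
   Context: Notation. $\|\cdot\|$ is the Euclidean norm (and induced matrix norm); $\delta_{ij}$ is the Kronecker delta; $\mathcal K$ is the class of continuous strictly increasing functions $\varphi:\mathbb R^+\to\mathbb R^+$ with $\varphi(0)=0$, $\mathbb R^+=[0,\infty)$ (condition 1 includes that $w_{11}^{-1}(P(x^0)-m_P)$ is defined). $L_gf(x)=\frac{\partial f(x)}{\partial x}g(x)$ and $[f,g]=L_fg-L_gf$. The state is $x\in D$, the control is $u\in\mathbb R^m$. Assumption 2 (time-independent form). (2.1) There exist index sets $S_1\subseteq\{1,\dots,m\}$, $S_2\subseteq\{1,\dots,m\}^2$ with $|S_1|+|S_2|=n$ and $\mathrm{span}\{f_i(x),[f_{j_1},f_{j_2}](x):i\in S_1,(j_1,j_2)\in S_2\}=\mathbb R^n$ for all $x\in D$. (2.2) Let $\mathcal F(x)$ be the (nonsingular) $n\times n$ matrix with columns $f_i(x)$, $i\in S_1$, followed by $[f_{j_1},f_{j_2}](x)$, $(j_1,j_2)\in S_2$. For any family of compact subsets $\widetilde{\mathcal D}_t\subset D$, $t\ge0$, there exists $M_F>0$ such that $\|\mathcal F^{-1}(x)\|\le M_F$ for all $t\ge0$, $x\in\widetilde{\mathcal D}_t$. Controls. Given $\gamma>0$, $\varepsilon>0$ and pairwise distinct positive integers $\kappa_{j_1j_2}$, $(j_1,j_2)\in S_2$, set $a(x)=-\gamma\mathcal F^{-1}(x)\nabla P(x)\in\mathbb R^n$, with components denoted $a_i$ ($i\in S_1$) and $a_{j_1j_2}$ ($(j_1,j_2)\in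 S_2$) in the order of the columns of $\mathcal F$, and for $k=1,\dots,m$ $$u_k^\varepsilon(a,t)=\sum_{i\in S_1}a_i\delta_{ki}+\varepsilon^{-1/2}\sum_{(j_1,j_2)\in S_2}\sqrt{|a_{j_1j_2}|}\,\phi^{(k,\varepsilon)}_{j_1j_2}(t),$$ $$\phi^{(k,\varepsilon)}_{j_1j_2}(t)=2\sqrt{\pi\kappa_{j_1j_2}}\Big(\delta_{kj_1}\mathrm{sign}(a_{j_1j_2})\cos\tfrac{2\pi\kappa_{j_1j_2}t}{\varepsilon}+\delta_{kj_2}\sin\tfrac{2\pi\kappa_{j_1j_2}t}{\varepsilon}\Big).$$ $\pi_\varepsilon$-solution. For $t_0\ge0$, $\varepsilon>0$ put $t_j=t_0+\varepsilon j$, $I_j=[t_j,t_{j+1})$, $j=0,1,2,\dots$. The $\pi_\varepsilon$-solution of the closed-loop system with $x_\pi(t_0)=x^0$ is an absolutely continuous function $x_\pi:[t_0,\infty)\to D$ with $x_\pi(t_0)=x^0$ and $\dot x_\pi(t)=\sum_{k=1}^mf_k(x_\pi(t))\,u_k^\varepsilon(a(x_\pi(t_j)),t)$ for $t\in I_j$, for each $j$. Asymptotic stability of $x^*$ (usual Lyapunov sense, with $\pi_\varepsilon$-solutions): for every $t_0\ge0$ and every $\epsilon>0$ there is $\delta>0$ such that $\|x^0-x^*\|\le\delta$ implies that $x_\pi$ is well-defined on $[t_0,\infty)$ and $\|x_\pi(t)-x^*\|\le\epsilon$ for all $t\ge t_0$; and there is $\Delta>0$ such that $\|x^0-x^*\|<\Delta$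 implies $x_\pi(t)\to x^*$ as $t\to+\infty$. *)

(* Defs.v *)
(* Points of R^n are columns 'cV[R]_n; fields and functions
   on a domain D are total functions of which only the germs at points of D
   are ever used. *)
From HB Require Import structures.
From mathcomp Require Import all_boot all_order all_algebra.
From mathcomp Require Import all_classical all_reals all_analysis.

Set Implicit Arguments.
Unset Strict Implicit.
Unset Printing Implicit Defensive.

Import Order.TTheory GRing.Theory Num.Theory.
Import numFieldNormedType.Exports.

Local Open Scope classical_set_scope.
Local Open Scope ring_scope.

(* The library norm on matrices is the sup norm; it induces the same topology
   as the Euclidean norm, so library limits and derivatives can be used. *)
Definition enorm (R : realType) (n : nat) (v : 'cV[R]_n) : R :=
  Num.sqrt (\sum_(i < n) v i 0 ^+ 2).

Definition opnorm (R : realType) (n : nat) (A : 'M[R]_n) : R :=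
  sup [set enorm (A *m v) | v in [set v : 'cV[R]_n | enorm v <= 1]].

Definition classK (R : realType) (w : R -> R) : Prop :=
  [/\ {within `[0, +oo[, continuous w},
      {in `[0, +oo[ &, {homo w : x y / x < y}},
      (forall x, 0 <= x -> 0 <= w x) & w 0 = 0].

(* Continuity of all 'D_v f is, in finite dimension, continuity of the Frechet
   derivative. *)
Fixpoint classC (R : realType) (V W : normedModType R) (k : nat) (D : set V)
    (f : V -> W) : Prop :=
  if k is k'.+1 then
    (forall x, D x -> differentiable f x) /\
    (forall v : V, classC k' D (fun x => 'D_v f x))
  else forall x, D x -> {for x, continuous f}.

Definition grad (R : realType) (n : nat) (P : 'cV[R]_n -> R) (x : 'cV[R]_n) :
    'cV[R]_n :=
  \col_(i < n) 'D_(delta_mx i 0 : 'cV[R]_n) (P : 'cV[R]_n -> R^o) x.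

(* lie_deriv g f is the L_g f of the literature, (df/dx) g. *)
Definition lie_deriv (R : realType) (n : nat) (g f : 'cV[R]_n -> 'cV[R]_n)
    (x : 'cV[R]_n) : 'cV[R]_n := 'd f x (g x).

Definition lie_bracket (R : realType) (n : nat) (f g : 'cV[R]_n -> 'cV[R]_n)
    (x : 'cV[R]_n) : 'cV[R]_n := lie_deriv f g x - lie_deriv g f x.

Section ControlAffine.
Variables (R : realType) (n m : nat).
Variables (f : 'I_m -> 'cV[R]_n -> 'cV[R]_n).
Variables (S1 : {set 'I_m}) (S2 : {set 'I_m * 'I_m}).

Definition spanning (x : 'cV[R]_n) : Prop :=
  (<<[seq f i x | i in S1] ++
     [seq lie_bracket (f j.1) (f j.2) x | j in S2]>> = fullv)%VS.

Hypothesis hn : (#|S1| + #|S2|)%N = n.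

Definition frame (x : 'cV[R]_n) : 'M[R]_n :=
  castmx (erefl n, hn)
    (row_mx
      (\matrix_(r < n, c < #|S1|) f (enum_val c) x r 0)
      (\matrix_(r < n, c < #|S2|)
         lie_bracket (f (enum_val c).1) (f (enum_val c).2) x r 0)).

Definition coef1 (a : 'cV[R]_n) (c : 'I_#|S1|) : R :=
  a (cast_ord hn (lshift #|S2| c)) 0.

Definition coef2 (a : 'cV[R]_n) (c : 'I_#|S2|) : R :=
  a (cast_ord hn (rshift #|S1| c)) 0.

Definition feedback (P : 'cV[R]_n -> R) (gamma : R) (x : 'cV[R]_n) :
    'cV[R]_n := - gamma *: (invmx (frame x) *m grad P x).

(* [s] is the coefficient a_j, whose sign enters the cosine term. *)
Definition oscillation (kap : nat) (eps s : R) (j : 'I_m * 'I_m) (k : 'I_m)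
    (t : R) : R :=
  2 * Num.sqrt (pi * kap%:R) *
  ((k == j.1)%:R * Num.sg s * cos (2 * pi * kap%:R * t / eps) +
   (k == j.2)%:R * sin (2 * pi * kap%:R * t / eps)).

Definition control (kappa : 'I_m * 'I_m -> nat) (eps : R) (a : 'cV[R]_n)
    (k : 'I_m) (t : R) : R :=
  \sum_(c < #|S1|) coef1 a c * (k == enum_val c)%:R +
  (Num.sqrt eps)^-1 *
    \sum_(c < #|S2|) Num.sqrt `|coef2 a c| *
      oscillation (kappa (enum_val c)) eps (coef2 a c) (enum_val c) k t.

End ControlAffine.

Definition abs_continuous (R : realType) (n : nat) (a b : R)
    (x : R -> 'cV[R]_n) : Prop :=
  forall e : R, 0 < e -> exists2 d : R, 0 < d &
    forall (N : nat) (l r : 'I_N -> R),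
      (forall i, a <= l i /\ l i <= r i /\ r i <= b) ->
      trivIset setT (fun i => `]l i, r i[%classic) ->
      \sum_(i < N) (r i - l i) < d ->
      \sum_(i < N) enorm (x (r i) - x (l i)) < e.

(* Derivative relative to I: one-sided at an end point belonging to I. *)
Definition has_deriv_within (R : realType) (n : nat) (I : set R)
    (x : R -> 'cV[R]_n) (t : R) (v : 'cV[R]_n) : Prop :=
  (s - t)^-1 *: (x s - x t) @[s --> within I t^'] --> v.

(* [u a k t] is the k-th control; absolute continuity on [t0, +oo[ is
   understood on its compact subintervals, and [x] is irrelevant before t0. *)
Definition pi_solution (R : realType) (n m : nat) (D : set 'cV[R]_n)
    (f : 'I_m -> 'cV[R]_n -> 'cV[R]_n) (u : 'cV[R]_n -> 'I_m -> R -> R)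
    (a : 'cV[R]_n -> 'cV[R]_n) (eps t0 : R) (x0 : 'cV[R]_n)
    (x : R -> 'cV[R]_n) : Prop :=
  [/\ forall t, t0 <= t -> D (x t),
      forall T, t0 <= T -> abs_continuous t0 T x,
      x t0 = x0 &
      forall (j : nat) (t : R),
        let tj := t0 + eps * j%:R in
        let I := `[tj, t0 + eps * j.+1%:R[%classic in
        I t ->
        has_deriv_within I x t
          (\sum_(k < m) u (a (x tj)) k t *: f k (x t))].

(* [sol t0 x0 x]: x is a solution on [t0, +oo[ with x t0 = x0. *)
Definition asymptotically_stable (R : realType) (n : nat)
    (sol : R -> 'cV[R]_n -> (R -> 'cV[R]_n) -> Prop) (xs : 'cV[R]_n) : Prop :=
  (forall t0 eta : R, 0 <= t0 -> 0 < eta ->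
    exists2 delta : R, 0 < delta &
      forall x0, enorm (x0 - xs) <= delta ->
        (exists x, sol t0 x0 x) /\
        (forall x, sol t0 x0 x ->
           forall t, t0 <= t -> enorm (x t - xs) <= eta)) /\
  (exists2 Delta : R, 0 < Delta &
    forall (t0 : R) x0, 0 <= t0 -> enorm (x0 - xs) < Delta ->
      (exists x, sol t0 x0 x) /\
      (forall x, sol t0 x0 x -> x t @[t --> +oo] --> xs)).

(* Main.v *)
(* Over a period of length eps the second-order (Volterra) expansion of a
   solution starting at y is x(eps) = y + eps F(y) a(y) + O((eps |a(y)|)^(3/2)):
   the trigonometric terms are mutually orthogonal, so that the double integrals
   of the controls produce exactly the brackets, whatever the initial phase.
   As F(y) a(y) = - gamma grad P(y) and |a| <= K |grad P|, this gives
   P(x(eps)) <= P(y) - eps (gamma / 2) |grad P(y)|^2 for small eps, uniformly on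
   a ball around x*.  Hence P is a Lyapunov function along the sampled solution;
   its level sets are controlled by w11 and w12, the displacement within a period
   is O(sqrt(|y - x*|)), and the sampled gradients cannot stay away from 0. *)
Require Import Defs.
From HB Require Import structures.
From mathcomp Require Import all_boot all_order all_algebra.
From mathcomp Require Import all_classical all_reals all_analysis.
From mathcomp Require Import ring lra zify.

Set Implicit Arguments.
Unset Strict Implicit.
Unset Printing Implicit Defensive.

Import Order.TTheory GRing.Theory Num.Theory.
Import numFieldNormedType.Exports.

Local Open Scope classical_set_scope.
Local Open Scope ring_scope.

(** * Mean value inequality *)

Section Calculus.
Context {R : realType}.

(** Everything is measured by h = sqrt(eps |a(y)|): the oscillating controls are O(h / eps) and
    their integrals O(h), while the constant parts of the controls are O(h^2 / eps). The remainder
    h^3 is h times eps |a(y)|, hence at most a constant times h eps |grad P(y)|: relative to the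
    first-order decrease it is a factor h, so it stays negligible even where the gradient is nearly
    zero. The obstacle is that a square root of a small distance exceeds the distance: between two
    samples the state may move much farther away than it was, and no decrease of P is available
    there. Only the sampled values of P are compared, and the motion inside a period is confined
    separately. Along solutions, integrals over a period enter as increments of functions with a
    prescribed derivative, so that the estimates reduce to mean value inequalities in the sup norm;
    passing to the Euclidean norm costs the factors n. *)

Lemma coord_le_norm m n (v : 'M[R]_(m, n)) i j : `|v i j| <= `|v|.
Proof.
rewrite [leRHS]/Num.Def.normr/= mx_normrE.
by apply/bigmax_geP; right; exists (i, j).
Qed.

Lemma norm_le_coord n (v : 'cV[R]_n) c :
  0 <= c -> (forall i, `|v i 0| <= c) -> `|v| <= c.
Proof.
move=> c0 vc; rewrite [leLHS]/Num.Def.normr/= mx_normrE.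
by apply/bigmax_leP; split => // -[i j] _ /=; rewrite ord1.
Qed.

Lemma continuous_coord (T : topologicalType) m n (f : T -> 'M[R]_(m, n)) x i j :
  {for x, continuous f} -> {for x, continuous (fun y => f y i j)}.
Proof.
move=> fx; apply: (@continuous_comp _ _ _ f (fun A => A i j) x) => //.
exact: coord_continuous.
Qed.

Lemma continuous_col (T : topologicalType) n (f : T -> 'cV[R]_n) x :
  (forall i, {for x, continuous (fun y => f y i 0)}) -> {for x, continuous f}.
Proof.
move=> fx; apply/cvgrPdist_le => e e0.
have H i : \forall y \near x, `|f x i 0 - f y i 0| <= e.
  by have /cvgrPdist_le/(_ _ e0) := fx i.
have {}H : \forall y \near x, forall i, `|f x i 0 - f y i 0| <= e.
  exact: filter_forall.
near=> y; apply: norm_le_coord => [|i]; first exact: ltW.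
by rewrite !mxE; move: i; near: y.
Unshelve. all: by end_near. Qed.

(** Continuity on the closed interval and a derivative inside it are what the mean value theorem
    takes; at sampling instants, where the controls may jump, a two-sided derivative is not to be
    expected. *)
Definition primitive_on (a b : R) n (X dX : R -> 'cV[R]_n) :=
  forall i, {within `[a, b], continuous (fun t => X t i 0)} /\
    (forall t : R, t \in `]a, b[ -> is_derive t 1 (fun t => X t i 0) (dX t i 0)).

Lemma primitive_on_cst a b n (v : 'cV[R]_n) :
  primitive_on a b (fun=> v) (fun=> 0).
Proof.
move=> i; split => [|t _]; first by apply: continuous_subspaceT => t; exact: cst_continuous.
by rewrite mxE; exact: is_derive_cst.
Qed.

Lemma primitive_onB a b n (X dX Y dY : R -> 'cV[R]_n) :
  primitive_on a b X dX -> primitive_on a b Y dY ->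
  primitive_on a b (fun t => X t - Y t) (fun t => dX t - dY t).
Proof.
move=> XP YP i; have [cX dX'] := XP i; have [cY dY'] := YP i.
rewrite (_ : (fun t => (X t - Y t) i 0) = (fun t => X t i 0) \- (fun t => Y t i 0)).
  split; first by move=> t; apply: continuousB; [exact: cX|exact: cY].
  by move=> t tab; rewrite !mxE; apply: is_deriveB; [exact: dX'|exact: dY'].
by apply/funext => t; rewrite !mxE.
Qed.

Lemma primitive_onD a b n (X dX Y dY : R -> 'cV[R]_n) :
  primitive_on a b X dX -> primitive_on a b Y dY ->
  primitive_on a b (fun t => X t + Y t) (fun t => dX t + dY t).
Proof.
move=> XP YP i; have [cX dX'] := XP i; have [cY dY'] := YP i.
rewrite (_ : (fun t => (X t + Y t) i 0) = (fun t => X t i 0) \+ (fun t => Y t i 0)).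
  split; first by move=> t; apply: continuousD; [exact: cX|exact: cY].
  by move=> t tab; rewrite !mxE; apply: is_deriveD; [exact: dX'|exact: dY'].
by apply/funext => t; rewrite !mxE.
Qed.

Lemma primitive_on_scale a b n (g dg : R -> R) (v : 'cV[R]_n) :
  (forall t : R, is_derive t 1 g (dg t)) ->
  primitive_on a b (fun t => g t *: v) (fun t => dg t *: v).
Proof.
move=> gd i; rewrite (_ : (fun t => (g t *: v) i 0) = v i 0 \*: g); last first.
  by apply/funext => t; rewrite !mxE mulrC.
have gv (t : R) : is_derive t 1 (v i 0 \*: g) ((dg t *: v) i 0).
  by rewrite mxE mulrC; apply: is_deriveZ.
split => [|t _]; last exact: gv.
apply: continuous_subspaceT => t.
by apply/differentiable_continuous/derivable1_diffP; case: (gv t).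
Qed.

Lemma primitive_on_sum a b n (I : Type) (r : seq I) (X dX : I -> R -> 'cV[R]_n) :
  (forall i, primitive_on a b (X i) (dX i)) ->
  primitive_on a b (fun t => \sum_(i <- r) X i t) (fun t => \sum_(i <- r) dX i t).
Proof.
move=> XP; elim: r => [|i r ih].
  have -> : (fun t => \sum_(i <- [::]) X i t) = fun=> 0.
    by apply/funext => t; rewrite big_nil.
  have -> : (fun t => \sum_(i <- [::]) dX i t) = fun=> 0.
    by apply/funext => t; rewrite big_nil.
  exact: primitive_on_cst.
have -> : (fun t => \sum_(j <- i :: r) X j t) = fun t => X i t + \sum_(j <- r) X j t.
  by apply/funext => t; rewrite big_cons.
have -> : (fun t => \sum_(j <- i :: r) dX j t) = fun t => dX i t + \sum_(j <- r) dX j t.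
  by apply/funext => t; rewrite big_cons.
exact: primitive_onD.
Qed.

Lemma primitive_on_sub a b c d n (X dX : R -> 'cV[R]_n) : a <= c -> d <= b ->
  primitive_on a b X dX -> primitive_on c d X dX.
Proof.
move=> ac db XP i; have [cX dX'] := XP i; split.
  by apply: continuous_subspaceW cX; apply: subset_itv; rewrite bnd_simp.
move=> t; rewrite in_itv/= => /andP[ct td]; apply: dX'.
by rewrite in_itv/= (le_lt_trans ac)// (lt_le_trans td).
Qed.

Lemma primitive_on_continuous a b n (X dX : R -> 'cV[R]_n) :
  primitive_on a b X dX -> {within `[a, b], continuous X}.
Proof.
by move=> XP t; apply: continuous_col => i; have [cX _] := XP i; exact: cX.
Qed.

Lemma mean_value_le (g dg : R -> R) (a b M : R) : a <= b ->
  {within `[a, b], continuous g} ->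
  (forall t : R, t \in `]a, b[ -> is_derive t 1 g (dg t)) ->
  (forall t, t \in `]a, b[ -> `|dg t| <= M) ->
  `|g b - g a| <= M * (b - a).
Proof.
move=> ab cg dgP dgM; move: ab; rewrite le_eqVlt => /predU1P[<-|ab].
  by rewrite !subrr normr0 mulr0.
have [c cab ->] := MVT ab dgP cg.
have ba : 0 <= b - a by rewrite subr_ge0 ltW.
by rewrite normrM (ger0_norm ba) ler_wpM2r// dgM.
Qed.

(** In the sup norm the scalar theorem applies to each coordinate separately and loses no
    constant. *)
Lemma mean_value_col n (X dX : R -> 'cV[R]_n) (a b M : R) : a <= b -> 0 <= M ->
  primitive_on a b X dX ->
  (forall t, t \in `]a, b[ -> `|dX t| <= M) ->
  `|X b - X a| <= M * (b - a).
Proof.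
move=> ab M0 XP dXM; apply: norm_le_coord => [|i].
  by rewrite mulr_ge0// subr_ge0.
rewrite !mxE; have [cX dX'] := XP i.
apply: (mean_value_le ab cX dX') => t /dXM; apply: le_trans.
exact: coord_le_norm.
Qed.

(* Treats scalar-valued and column-valued maps at once. *)
Definition mean_value_space (W : normedModType R) :=
  forall (g dg : R -> W) (M : R),
    (forall s : R, 0 <= s <= 1 -> is_derive s 1 g (dg s)) ->
    (forall s : R, 0 <= s <= 1 -> `|dg s| <= M) -> `|g 1 - g 0| <= M.

Lemma mean_value_space_real : mean_value_space R^o.
Proof.
move=> g dg M gP gM; have := @mean_value_le g dg 0 1 M ler01.
rewrite subr0 mulr1; apply.
- apply: derivable_within_continuous => t; rewrite in_itv/= => /gP[]//.
- by move=> t; rewrite in_itv/= => /andP[t0 t1]; apply: gP; rewrite !ltW.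
- by move=> t; rewrite in_itv/= => /andP[t0 t1]; apply: gM; rewrite !ltW.
Qed.

Lemma is_derive_coord n (g : R -> 'cV[R]_n) (t : R) v i :
  is_derive t 1 g v -> is_derive t 1 (fun s => g s i 0) (v i 0).
Proof.
move=> [gd gv]; split; first by have /derivable_mxP := gd; apply.
by rewrite -gv derive_mx// mxE.
Qed.

Lemma mean_value_space_col n : mean_value_space 'cV[R]_n.
Proof.
move=> g dg M gP gM; have := @mean_value_col n g dg 0 1 M ler01.
rewrite subr0 mulr1; apply.
- by rewrite (le_trans _ (gM 0 _))// lexx ler01.
- move=> i; split.
    apply: derivable_within_continuous => t; rewrite in_itv/= => /gP gt.
    by have [] := is_derive_coord i gt.
  move=> t; rewrite in_itv/= => /andP[t0 t1]; apply: is_derive_coord.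
  by apply: gP; rewrite !ltW.
- by move=> t; rewrite in_itv/= => /andP[t0 t1]; apply: gM; rewrite !ltW.
Qed.

Section Segment.
Variables (V W : normedModType R).
Hypothesis mvW : mean_value_space W.

Lemma is_derive_segment (f : V -> W) x v (s : R) :
  differentiable f (x + s *: v) ->
  is_derive s 1 (fun s : R => f (x + s *: v)) ('D_v f (x + s *: v)).
Proof.
move=> fd.
have pd : is_diff s (fun s : R => x + s *: v) ( *:%R^~ v).
  have -> : (fun s : R => x + s *: v) = cst x + ( *:%R^~ v) by [].
  have := is_diffD (is_diff_cst x s) (is_diff_scalel s v).
  by rewrite add0r.
have [pd1 pd2] := pd.
split; first by apply: diff_derivable; exact: differentiable_comp.
rewrite deriveE; last exact: differentiable_comp.
rewrite (_ : (fun s => f _) = f \o (fun s : R => x + s *: v))//.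
by rewrite diff_comp//= pd2 scale1r -deriveE.
Qed.

Lemma segment_increment_le (f : V -> W) x v M :
  (forall s : R, 0 <= s <= 1 -> differentiable f (x + s *: v)) ->
  (forall s : R, 0 <= s <= 1 -> `|'D_v f (x + s *: v)| <= M) ->
  `|f (x + v) - f x| <= M.
Proof.
move=> fd fM.
have := @mvW (fun s => f (x + s *: v)) (fun s => 'D_v f (x + s *: v)) M.
rewrite scale1r scale0r addr0; apply => // s s01.
exact/is_derive_segment/fd.
Qed.

End Segment.
End Calculus.

(** * First- and second-order estimates on a ball *)

Section BallEstimates.
Context {R : realType} (n : nat).
Variables (D : set 'cV[R]_n) (c : 'cV[R]_n) (r : R).
Hypothesis r0 : 0 <= r.
Let B := [set x : 'cV[R]_n | `|x - c| <= r].

(** The ball is a product of segments; compactness of such products of rows is carried to columns by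
    transposition. *)
Lemma compact_sup_ball : compact B.
Proof.
have -> : B = trmx @` [set v : 'rV[R]_n |
    forall i, `[c i 0 - r, c i 0 + r]%classic (v ord0 i)].
  apply/seteqP; split => [x xB|_ [v vP <-]] /=.
    exists x^T; last exact: trmxK.
    move=> i /=; rewrite in_itv/= mxE -ler_distl.
    by have := coord_le_norm (x - c) i 0; rewrite !mxE => /le_trans; exact.
  apply: norm_le_coord => // i; rewrite !mxE ler_distl.
  by have := vP i; rewrite /= in_itv.
apply: continuous_compact; last first.
  apply: (@rV_compact _ _ (fun i => `[c i 0 - r, c i 0 + r]%classic)) => i.
  exact: segment_compact.
apply: continuous_subspaceT => v; apply: continuous_col => i.
rewrite (_ : (fun y => _) = (fun y : 'rV[R]_n => y 0 i)); last first.
  by apply/funext => y; rewrite mxE.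
exact: coord_continuous.
Qed.

Lemma ball_segment x y (s : R) : B x -> B y -> 0 <= s <= 1 -> B (y + s *: (x - y)).
Proof.
rewrite /B /= => Bx By /andP[s0 s1].
have -> : y + s *: (x - y) - c = s *: (x - c) + (1 - s) *: (y - c).
  by rewrite !scalerBr !scalerBl !scale1r; apply/matrixP => i j; rewrite !mxE; ring.
rewrite (le_trans (ler_normD _ _))// !normrZ ger0_norm// ger0_norm ?subr_ge0//.
have -> : r = s * r + (1 - s) * r by ring.
by rewrite lerD// ler_wpM2l// subr_ge0.
Qed.

Hypothesis BD : B `<=` D.

(** Bounds are stated for all sufficiently large constants: finitely many of them then hold with one
    common constant, by intersecting neighbourhoods of infinity. *)
Lemma near_ball_bounded (W : normedModType R) (g : 'cV[R]_n -> W) :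
  (forall x, D x -> {for x, continuous g}) ->
  \forall K \near +oo%R, forall x, B x -> `|g x| <= K.
Proof.
move=> gc.
have : compact (g @` B).
  apply: continuous_compact; last exact: compact_sup_ball.
  apply: continuous_in_subspaceT => x; rewrite inE => /BD; exact: gc.
move=> /compact_bounded gB; near=> K => x Bx.
have gBK : globally (g @` B) [set y | `|y| <= K] by near: K.
by apply: gBK; exists x.
Unshelve. all: by end_near.
Qed.

Variables (W : normedModType R).
Implicit Types f : 'cV[R]_n -> W.

Lemma derive_coords f x v : differentiable f x ->
  'D_v f x = \sum_(j < n) v j 0 *: 'D_(delta_mx j 0 : 'cV[R]_n) f x.
Proof.
move=> fd; rewrite deriveE// [in LHS](matrix_sum_delta v) linear_sum/=.
apply: eq_bigr => j _; rewrite big_ord1 linearZ/= deriveE//.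
Qed.

Lemma sum_coords_le (v : 'cV[R]_n) (w : 'I_n -> W) K :
  (forall j, `|w j| <= K) -> `|\sum_(j < n) v j 0 *: w j| <= n%:R * K * `|v|.
Proof.
move=> wK; rewrite (le_trans (ler_norm_sum _ _ _))//.
rewrite (le_trans (_ : _ <= \sum_(j < n) K * `|v|))//.
  apply: ler_sum => j _; rewrite normrZ mulrC ler_pM//; exact: coord_le_norm.
by rewrite sumr_const card_ord -[leLHS]mulr_natl mulrA.
Qed.

(** [classC] controls one direction at a time; expanding v in the canonical basis makes the bound
    linear in v and uniform over the ball. *)
Lemma near_derive_bounded f : classC 1 D f ->
  \forall K \near +oo%R, forall x v, B x -> `|'D_v f x| <= K * `|v|.
Proof.
move=> [fd fc].
have [K [_ KP]] : \forall K \near +oo%R, forall j x, B x ->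
    `|'D_(delta_mx j 0 : 'cV[R]_n) f x| <= K.
  by apply: filter_forall => j; apply: near_ball_bounded; exact: fc.
near=> L => x v Bx; rewrite derive_coords; last exact/fd/BD.
(* A neighbourhood of infinity contains the constants strictly above K, hence K + 1. *)
apply: le_trans (sum_coords_le _ _) _; first by move=> j; apply: (KP (K + 1)); rewrite ?ltrDl.
rewrite ler_wpM2r//; near: L; exact: nbhs_pinfty_ge.
Unshelve. all: by end_near. Qed.

Hypothesis mvW : mean_value_space W.

Lemma near_ball_lipschitz f : classC 1 D f ->
  \forall K \near +oo%R, forall x y, B x -> B y -> `|f x - f y| <= K * `|x - y|.
Proof.
move=> f1; have := near_derive_bounded f1; apply: filterS => K KP x y Bx By.
have := @segment_increment_le _ _ _ mvW f y (x - y) (K * `|x - y|).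
rewrite subrKC; apply => s s01; last by apply: KP; exact: ball_segment.
by have [fd _] := f1; apply/fd/BD/ball_segment.
Qed.
End BallEstimates.

Section SecondOrder.
Context {R : realType} (n : nat).
Variables (D : set 'cV[R]_n) (c : 'cV[R]_n) (r : R).
Hypothesis r0 : 0 <= r.
Let B := [set x : 'cV[R]_n | `|x - c| <= r].
Hypothesis BD : B `<=` D.
Variables (W : normedModType R).
Hypothesis mvW : mean_value_space W.

Lemma near_derive_lipschitz (f : 'cV[R]_n -> W) : classC 2 D f ->
  \forall K \near +oo%R, forall x y v, B x -> B y ->
    `|'D_v f x - 'D_v f y| <= K * `|x - y| * `|v|.
Proof.
move=> [fd f2].
have [K [_ KP]] : \forall K \near +oo%R, forall j x y, B x -> B y ->
    `|'D_(delta_mx j 0 : 'cV[R]_n) f x - 'D_(delta_mx j 0 : 'cV[R]_n) f y| <= K * `|x - y|.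
  apply: filter_forall => j; apply: (near_ball_lipschitz r0 BD mvW); exact: f2.
near=> L => x y v Bx By.
have fdx := fd _ (BD Bx); have fdy := fd _ (BD By).
rewrite (derive_coords v fdx) (derive_coords v fdy) -sumrB.
under eq_bigr do rewrite -scalerBr.
apply: le_trans (sum_coords_le _ _) _.
  by move=> j; apply: (KP (K + 1)); rewrite ?ltrDl.
rewrite ler_wpM2r// mulrA ler_wpM2r//; near: L; exact: nbhs_pinfty_ge.
Unshelve. all: by end_near. Qed.

(** The mean value inequality is applied to f minus its differential at y: along the segment the
    derivative of this difference is an increment of the derivative of f, which
    [near_derive_lipschitz] bounds. The sharp factor 1/2 is given up. *)
Lemma near_ball_taylor (f : 'cV[R]_n -> W) : classC 2 D f ->
  \forall K \near +oo%R, forall x y, B x -> B y ->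
    `|f x - f y - 'D_(x - y) f y| <= K * `|x - y| ^+ 2.
Proof.
move=> f2; have KP := near_derive_lipschitz f2.
near=> K => x y Bx By.
have fdy : differentiable f y by case: f2 => fd _; apply/fd/BD.
pose d : 'cV[R]_n -> W := 'd f y.
have ld (z : 'cV[R]_n) : is_diff z d d.
  by split; [exact/linear_differentiable/diff_continuous|
             rewrite diff_lin//; exact: diff_continuous].
have fdz (s : R) : 0 <= s <= 1 -> differentiable f (y + s *: (x - y)).
  by move=> s01; case: f2 => fd _; apply/fd/BD/ball_segment.
have dg (s : R) : 0 <= s <= 1 -> differentiable (f - d) (y + s *: (x - y)).
  move=> s01; apply: differentiableB; first exact: fdz.
  by case: (ld (y + s *: (x - y))).
have := @segment_increment_le _ _ _ mvW (f - d) y (x - y) (K * `|x - y| ^+ 2).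
rewrite subrKC deriveE//.
have fdE : (f - d) x - (f - d) y = f x - f y - 'd f y (x - y).
  have dB : 'd f y (x - y) = d x - d y by rewrite linearB.
  rewrite dB -[LHS]/((f x - d x) - (f y - d y)) !opprB addrACA [RHS]addrACA.
  by rewrite [in RHS](addrC (- f y)).
rewrite fdE; apply => // s s01; rewrite deriveE; last exact: dg.
have [l1 l2] := ld (y + s *: (x - y)).
rewrite (diffB (fdz s s01) l1).
have -> : ('d f (y + s *: (x - y)) \- 'd d (y + s *: (x - y))) (x - y)
  = 'D_(x - y) f (y + s *: (x - y)) - 'D_(x - y) f y.
  by rewrite /= l2 (deriveE _ (fdz s s01)) (deriveE _ fdy).
have KD : forall x y v, B x -> B y -> `|'D_v f x - 'D_v f y| <= K * `|x - y| * `|v|.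
  by near: K.
have /(_ (x - y)) := KD _ _ _ (ball_segment Bx By s01) By.
move=> /le_trans; apply; rewrite addrAC subrr add0r normrZ expr2 [leRHS]mulrA.
have /andP[s0 s1] := s01.
have K0 : 0 <= K by near: K; exact: nbhs_pinfty_ge.
apply: ler_wpM2r; first exact: normr_ge0.
apply: ler_wpM2l; first exact: K0.
rewrite ger0_norm; last exact: s0.
by apply: ler_piMl; [exact: normr_ge0|exact: s1].
Unshelve. all: by end_near. Qed.

End SecondOrder.

(** * Euclidean norm and frame *)

Section Enorm.
Context {R : realType} (n : nat).
Implicit Types v : 'cV[R]_n.

Lemma norm_le_enorm v : `|v| <= enorm v.
Proof.
apply: norm_le_coord => [|i]; first exact: sqrtr_ge0.
rewrite -sqrtr_sqr ler_wsqrtr// (bigD1 i)//= lerDl.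
by apply: sumr_ge0 => j _; exact: sqr_ge0.
Qed.

Lemma enorm_le_norm v : enorm v <= n%:R * `|v|.
Proof.
have nv0 : 0 <= n%:R * `|v| by rewrite mulr_ge0.
rewrite -(ger0_norm nv0) -sqrtr_sqr ler_wsqrtr//.
apply: (@le_trans _ _ (\sum_(i < n) `|v| ^+ 2)).
  apply: ler_sum => i _; rewrite -(real_normK (num_real (v i 0))).
  by rewrite ler_sqr ?nnegrE// coord_le_norm.
rewrite sumr_const card_ord -[leLHS]mulr_natl exprMn ler_wpM2r ?sqr_ge0//.
by rewrite -natrX ler_nat -mulnn; case: (posnP n) => [->|]// /leq_pmulr.
Qed.

Lemma enorm_ge0 v : 0 <= enorm v. Proof. exact: sqrtr_ge0. Qed.

Lemma enormZ a v : enorm (a *: v) = `|a| * enorm v.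
Proof.
rewrite /enorm -sqrtr_sqr -sqrtrM ?sqr_ge0// mulr_sumr.
by congr Num.sqrt; apply: eq_bigr => i _; rewrite mxE exprMn.
Qed.

Lemma enorm0_eq0 v : enorm v = 0 -> v = 0.
Proof.
by move=> v0; apply/eqP; rewrite -normr_le0 -v0 norm_le_enorm.
Qed.

Lemma mulmx_norm_le (A : 'M[R]_n) v : `|A *m v| <= n%:R * `|A| * `|v|.
Proof.
apply: norm_le_coord => [|i]; first by rewrite !mulr_ge0.
rewrite mxE (le_trans (ler_norm_sum _ _ _))//.
apply: (@le_trans _ _ (\sum_(i < n) `|A| * `|v|)).
  by apply: ler_sum => j _; rewrite normrM ler_pM// coord_le_norm.
by rewrite sumr_const card_ord -[leLHS]mulr_natl mulrA.
Qed.

Lemma opnormP (A : 'M[R]_n) v : enorm (A *m v) <= opnorm A * enorm v.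
Proof.
have [/eqP/enorm0_eq0 ->|v0] := boolP (enorm v == 0).
  by rewrite mulmx0 -(scale0r (0 : 'cV[R]_n)) enormZ normr0 mul0r mulr0.
have v_gt0 : 0 < enorm v by rewrite lt_neqAle eq_sym v0 enorm_ge0.
rewrite -ler_pdivrMr// mulrC -[X in X * _]gtr0_norm ?invr_gt0// -enormZ.
rewrite scalemxAr; apply: ub_le_sup; last first.
  exists ((enorm v)^-1 *: v) => //=.
  by rewrite enormZ gtr0_norm ?invr_gt0// mulVf.
(* The supremum in [opnorm] dominates the members of its set once the set is bounded; the sup-norm
   estimate supplies a bound. *)
exists (n%:R * (n%:R * `|A|)) => _ [w /= w1 <-].
rewrite (le_trans (enorm_le_norm _))// ler_wpM2l//.
rewrite (le_trans (mulmx_norm_le _ _))// -[leRHS]mulr1 ler_wpM2l ?mulr_ge0//.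
exact: le_trans (norm_le_enorm w) w1.
Qed.
End Enorm.

Section Frame.
Context {R : realType} (n m : nat).
Variables (f : 'I_m -> 'cV[R]_n -> 'cV[R]_n).
Variables (S1 : {set 'I_m}) (S2 : {set 'I_m * 'I_m}).
Hypothesis hn : (#|S1| + #|S2|)%N = n.

Lemma frame_lshift x i c :
  frame f hn x i (cast_ord hn (lshift #|S2| c)) = f (enum_val c) x i 0.
Proof.
by rewrite castmxE /= cast_ordK cast_ord_id row_mxEl mxE.
Qed.

Lemma frame_rshift x i c : frame f hn x i (cast_ord hn (rshift #|S1| c)) =
  lie_bracket (f (enum_val c).1) (f (enum_val c).2) x i 0.
Proof.
by rewrite castmxE /= cast_ordK cast_ord_id row_mxEr mxE.
Qed.

(** The form in which the averaged fields and brackets of the expansion are recognised as the frame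
    applied to the feedback. *)
Lemma frame_mulmx x (a : 'cV[R]_n) : frame f hn x *m a =
  \sum_(c < #|S1|) Defs.coef1 hn a c *: f (enum_val c) x +
  \sum_(c < #|S2|) coef2 hn a c *:
    lie_bracket (f (enum_val c).1) (f (enum_val c).2) x.
Proof.
apply/colP => i; rewrite mxE [RHS]mxE !summxE.
rewrite (reindex (cast_ord hn)) /=; last first.
  by exists (cast_ord (esym hn)) => j _; rewrite ?cast_ordK ?cast_ordKV.
rewrite big_split_ord /=; congr (_ + _); apply: eq_bigr => c _.
  by rewrite frame_lshift mxE mulrC.
by rewrite frame_rshift [RHS]mxE mulrC.
Qed.

(** All the spanning vectors are columns of the frame, so its image is the whole space; solving for
    the basis vectors gives a right inverse, which for a square matrix is an inverse. *)
Lemma frame_unitmx x : spanning f S1 S2 x -> frame f hn x \in unitmx.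
Proof.
rewrite /spanning => spanE.
pose U := limg (linfun (mulmx (frame f hn x) : 'cV[R]_n -> 'cV[R]_n)).
have colU j : col j (frame f hn x) \in U.
  by rewrite colE -lfunE memv_img// memvf.
have U1 : (fullv <= U)%VS.
  rewrite -spanE; apply/span_subvP => v; rewrite mem_cat.
  move=> /orP[] /mapP[c]; rewrite mem_enum => cS vE.
    have -> : v = col (cast_ord hn (lshift #|S2| (enum_rank_in cS c))) (frame f hn x).
      by rewrite vE; apply/colP => i; rewrite mxE frame_lshift enum_rankK_in.
    exact: colU.
  have -> : v = col (cast_ord hn (rshift #|S1| (enum_rank_in cS c))) (frame f hn x).
    by rewrite vE; apply/colP => i; rewrite [RHS]mxE frame_rshift enum_rankK_in.
  exact: colU.
have ex j : exists w : 'cV[R]_n, frame f hn x *m w = delta_mx j 0.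
  have /memv_imgP[w _ wE] : delta_mx j 0 \in U by apply: (subvP U1); exact: memvf.
  by exists w; rewrite wE lfunE.
have [w wE] := choice ex.
have : frame f hn x *m (\matrix_(i, j) w j i 0) = 1%:M.
  apply/matrixP => i j; have := congr1 (fun A : 'cV[R]_n => A i 0) (wE j).
  rewrite !mxE eqxx andbT => <-; apply: eq_bigr => k _.
  by rewrite mxE.
by case/mulmx1_unit.
Qed.

Lemma frame_feedback P gamma x : spanning f S1 S2 x ->
  frame f hn x *m feedback f hn P gamma x = - gamma *: grad P x.
Proof.
by move=> xS; rewrite -scalemxAr mulKVmx// frame_unitmx.
Qed.

(** The factor n is the cost of measuring the gradient in the sup norm while [opnorm] is
    Euclidean. *)
Lemma feedback_norm_le P gamma x MF : opnorm (invmx (frame f hn x)) <= MF ->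
  `|feedback f hn P gamma x| <= `|gamma| * `|MF| * n%:R * `|grad P x|.
Proof.
move=> FM; rewrite normrZ normrN -!mulrA ler_wpM2l//.
rewrite (le_trans (norm_le_enorm _))// (le_trans (opnormP _ _))//.
apply: (le_trans (ler_wpM2r (enorm_ge0 _) FM)).
apply: (le_trans (ler_wpM2r (enorm_ge0 _) (ler_norm MF))).
by rewrite ler_wpM2l// enorm_le_norm.
Qed.
End Frame.

(** * Existence of solutions *)

Section Picard.
Context {R : realType}.

Lemma ex_primitive (g : R -> R) (a b : R) : continuous g ->
  exists G : R -> R, G a = 0 /\
    forall t, a <= t <= b -> is_derive t 1 G (g t).
Proof.
(* Integrating from a - 1, inside a domain reaching to b + 1, makes both ends of [a, b] interior, so
   that the derivative is two-sided there. *)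
move=> gc; pose H t := (\int[lebesgue_measure]_(s in `[a - 1, t]) g s)%R.
exists (fun t => H t - H a); split => [|t /andP[at_ tb]]; first by rewrite subrr.
have tb1 : t < b + 1 by rewrite ltr_pwDr.
have a1t : a - 1 < t by rewrite ltrBlDr ltr_pwDr.
have ig : lebesgue_measure.-integrable `[a - 1, b + 1] (EFin \o g).
  apply: continuous_compact_integrable; first exact: segment_compact.
  exact: continuous_subspaceT.
have [dH HE] := continuous_FTC1_closed tb1 ig a1t (gc t).
have Hd : is_derive t 1 H (g t).
  by split; [exact: dH|rewrite -derive1E; exact: HE].
have := is_deriveB Hd (is_derive_cst (H a) t 1).
by rewrite subr0.
Qed.

Variables (n : nat) (a b : R).
Hypothesis ab : a <= b.

(* Clamping the time makes the integrands of the Picard iteration, which are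
   only known on [a, b], continuous on the whole line. *)
Let clamp (t : R) := Num.max a (Num.min b t).

Lemma clamp_itv t : a <= clamp t <= b.
Proof. by rewrite /clamp le_max lexx/= ge_max ab ge_min lexx. Qed.

Lemma clamp_id t : a <= t <= b -> clamp t = t.
Proof. by move=> /andP[at_ tb]; rewrite /clamp min_r// max_r. Qed.

Lemma clamp_continuous : continuous clamp.
Proof.
move=> t; apply: continuous_max; first exact: cst_continuous.
by apply: continuous_min; [exact: cst_continuous|exact: cvg_id].
Qed.

Lemma continuous_comp_clamp (T : topologicalType) (Y : R -> T) :
  (forall t, a <= t <= b -> {for t, continuous Y}) -> continuous (Y \o clamp).
Proof.
move=> Yc t; apply: continuous_comp; first exact: clamp_continuous.
exact/Yc/clamp_itv.
Qed.

Variables (F : R -> 'cV[R]_n -> 'cV[R]_n) (x0 : 'cV[R]_n) (L M : R).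
Hypothesis F_cont : forall y : R -> 'cV[R]_n, continuous y ->
  continuous (fun t => F t (y t)).
Hypothesis F_lip : forall t x y, a <= t <= b -> `|F t x - F t y| <= L * `|x - y|.
Hypothesis F_le : forall t x, a <= t <= b -> `|F t x| <= M.
Hypothesis L_ge0 : 0 <= L.
Hypothesis Lab : L * (b - a) <= 2^-1.

Let good (Y : R -> 'cV[R]_n) := forall t, a <= t <= b -> {for t, continuous Y}.
Let step (Y Z : R -> 'cV[R]_n) := Z a = x0 /\
  forall t i, a <= t <= b -> is_derive t 1 (fun s => Z s i 0) (F t (Y t) i 0).

Lemma step_good Y Z : step Y Z -> good Z.
Proof.
move=> [_ YZ] t tab; apply: continuous_col => i.
apply/differentiable_continuous/derivable1_diffP.
by have [] := YZ t i tab.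
Qed.

Lemma ex_step Y : good Y -> exists Z, step Y Z.
Proof.
move=> Yg.
have Fc : continuous (fun t => F t (Y (clamp t))).
  exact/F_cont/continuous_comp_clamp.
have /choice[G GP] : forall i, exists G : R -> R, G a = 0 /\
    forall t, a <= t <= b -> is_derive t 1 G (F t (Y (clamp t)) i 0).
  move=> i; apply: (@ex_primitive (fun t => F t (Y (clamp t)) i 0)) => t.
  exact/continuous_coord/Fc.
exists (fun t => \col_i (x0 i 0 + G i t)); split.
  by apply/colP => i; rewrite mxE (GP i).1 addr0.
move=> t i tab; have := (GP i).2 t tab; rewrite clamp_id// => Gd.
rewrite (_ : (fun s => _) = cst (x0 i 0) + G i); last first.
  by apply/funext => s; rewrite mxE.
have := is_deriveD (is_derive_cst (x0 i 0) t 1) Gd.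
by rewrite add0r.
Qed.

Lemma step_primitive Y Z s t : step Y Z -> a <= s -> t <= b ->
  primitive_on s t Z (fun r => F r (Y r)).
Proof.
move=> YZ as_ tb i; split.
  apply: continuous_in_subspaceT => r; rewrite inE/= in_itv/= => /andP[sr rt].
  apply: continuous_coord; apply: (step_good YZ).
  by rewrite (le_trans as_)// (le_trans rt).
move=> r; rewrite in_itv/= => /andP[sr rt]; apply: YZ.2.
by rewrite (le_trans as_ (ltW sr))// (le_trans (ltW rt)).
Qed.

Lemma step_contract Y Z Y' Z' K : step Y Z -> step Y' Z' -> 0 <= K ->
  (forall t, a <= t <= b -> `|Y t - Y' t| <= K) ->
  forall t, a <= t <= b -> `|Z t - Z' t| <= K / 2.
Proof.
move=> YZ YZ' K0 YK t /andP[at_ tb].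
have P := primitive_onB (step_primitive YZ (lexx a) tb)
  (step_primitive YZ' (lexx a) tb).
have LK : 0 <= L * K by rewrite mulr_ge0.
have := mean_value_col at_ LK P.
rewrite YZ.1 YZ'.1 subrr subr0 => H; apply: (le_trans (H _)).
  move=> s; rewrite in_itv/= => /andP[as_ st].
  have sab : a <= s <= b by rewrite (ltW as_) (le_trans (ltW st)).
  by rewrite (le_trans (F_lip _ _ sab))// ler_wpM2l// YK.
rewrite mulrAC mulrC ler_wpM2l// (le_trans _ Lab)// ler_wpM2l// lerB//.
Qed.

Lemma step_lipschitz Y Z s t : step Y Z -> a <= s -> s <= t -> t <= b ->
  `|Z t - Z s| <= M * (t - s).
Proof.
move=> YZ as_ st tb; have P := step_primitive YZ as_ tb.
apply: (mean_value_col st _ P) => [|r]; last first.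
  rewrite in_itv/= => /andP[sr rt]; apply: F_le.
  by rewrite (le_trans as_ (ltW sr))// (le_trans (ltW rt)).
by apply: le_trans (F_le 0 (_ : a <= a <= b)); rewrite ?lexx.
Qed.

(** Since L (b - a) is at most 1/2, each step halves distances and the iterates converge
    geometrically; the Lipschitz constant M common to the iterates passes to the limit, whose
    continuity allows one more step. *)
Theorem picard_lindelof : exists X : R -> 'cV[R]_n, X a = x0 /\
  forall t i, a <= t <= b -> is_derive t 1 (fun s => X s i 0) (F t (X t) i 0).
Proof.
have /choice[Phi PhiP] : forall Y, exists Z, good Y -> step Y Z.
  move=> Y; have [/ex_step[Z YZ]|nY] := pselect (good Y); first by exists Z.
  by exists Y.
pose Y k := iter k Phi (cst x0).
have Yg k : good (Y k).
  elim: k => [|k ih]; first by move=> t _; exact: cst_continuous.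
  exact: step_good (PhiP _ ih).
have YS k : step (Y k) (Y k.+1) by exact: PhiP.
pose C := M * (b - a).
have M0 : 0 <= M by apply: le_trans (F_le 0 (_ : a <= a <= b)); rewrite ?lexx.
have C0 : 0 <= C by rewrite mulr_ge0// subr_ge0.
have Y1 k t : a <= t <= b -> `|Y k.+1 t - Y k t| <= C * 2^-1 ^+ k.
  elim: k t => [|k ih] t tab.
    have /andP[at_ tb] := tab.
    have := step_lipschitz (YS 0%N) (lexx a) at_ tb.
    rewrite (YS 0%N).1 expr0 mulr1 => /le_trans; apply.
    by rewrite ler_wpM2l// lerB.
  have := step_contract (YS k.+1) (YS k) _ ih tab.
  by rewrite exprSr mulrA; apply; rewrite mulr_ge0// exprn_ge0// invr_ge0.
have Y2 k p t : a <= t <= b -> `|Y (k + p)%N t - Y k t| <= 2 * C * 2^-1 ^+ k.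
  move=> tab.
  have : `|Y (k + p)%N t - Y k t| <= 2 * C * (2^-1 ^+ k - 2^-1 ^+ (k + p)).
    elim: p => [|p ih]; first by rewrite addn0 !subrr normr0 mulr0.
    have := Y1 (k + p)%N t tab; rewrite addnS => h.
    rewrite -(subrKA (Y (k + p)%N t)) (le_trans (ler_normD _ _))//.
    rewrite (le_trans (lerD h ih))// exprS.
    by rewrite le_eqVlt; apply/orP; left; apply/eqP; field.
  move=> /le_trans; apply; apply: ler_wpM2l; first by rewrite mulr_ge0.
  by rewrite gerBl exprn_ge0// invr_ge0.
have geo : (fun k => 2 * C * 2^-1 ^+ k : R) @ \oo --> (0 : R).
  rewrite -[X in _ --> X](mulr0 (2 * C)); apply: cvgMr.
  by apply: cvg_expr; rewrite ger0_norm ?invr_ge0// invf_lt1// ltr1n.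
have Ycvg t : a <= t <= b -> cvg (Y k t @[k --> \oo]).
  move=> tab; apply/cauchy_cvgP/cauchyP => e e0.
  have /cvgrPdist_lt/(_ e e0)[N _ NP] := geo.
  exists (Y N t); exists N => // k /= Nk.
  rewrite -ball_normE /= distrC -(subnKC Nk) (le_lt_trans (Y2 _ _ _ tab))//.
  have := NP N (leqnn N); rewrite /= sub0r normrN; exact/le_lt_trans/ler_norm.
pose X t := lim (Y k t @[k --> \oo]).
have XY k t : a <= t <= b -> `|X t - Y k t| <= 2 * C * 2^-1 ^+ k.
  move=> tab; have Yt := Ycvg t tab.
  have : `|Y p t - Y k t| @[p --> \oo] --> `|X t - Y k t|.
    by apply: cvg_norm; apply: cvgB => //; exact: cvg_cst.
  move=> /cvgr_to_le; apply; near=> p.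
  have kp : (k <= p)%N by near: p; exact: nbhs_infty_ge.
  by rewrite -(subnKC kp); exact: Y2.
have Xlip s t : a <= s -> s <= t -> t <= b -> `|X t - X s| <= M * (t - s).
  move=> as_ st tb.
  have sab : a <= s <= b by rewrite as_ (le_trans st).
  have tab : a <= t <= b by rewrite tb (le_trans as_).
  have : `|Y p.+1 t - Y p.+1 s| @[p --> \oo] --> `|X t - X s|.
    apply: cvg_norm; apply: cvgB.
      by rewrite (cvg_shiftS (fun p => Y p t)); exact: Ycvg.
    by rewrite (cvg_shiftS (fun p => Y p s)); exact: Ycvg.
  move=> /cvgr_to_le; apply; near=> p.
  exact: step_lipschitz (YS p) as_ st tb.
have Xlip' s t : a <= s <= b -> a <= t <= b -> `|X t - X s| <= M * `|t - s|.
  move=> /andP[as_ sb] /andP[at_ tb]; have [st|/ltW ts] := leP s t.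
    by rewrite (ger0_norm (_ : 0 <= t - s)) ?subr_ge0// Xlip.
  by rewrite distrC (distrC t) (ger0_norm (_ : 0 <= s - t)) ?subr_ge0// Xlip.
have Xc : continuous (X \o clamp).
  move=> t; apply/cvgrPdist_lt => e e0.
  have M1 : 0 < M + 1 by rewrite ltr_wpDl.
  have /cvgrPdist_lt/(_ (e / (M + 1)) (divr_gt0 e0 M1)) := @clamp_continuous t.
  apply: filterS => s; rewrite ltr_pdivlMr// => h /=.
  rewrite (le_lt_trans (Xlip' _ _ (clamp_itv s) (clamp_itv t)))//.
  by rewrite (le_lt_trans _ h)// mulrC ler_wpM2l// lerDl.
(* The solution is the image Z of the limit under one more step: X is a pointwise limit with no
   control outside [a, b], whereas Z has two-sided derivatives at both ends. *)
have [Z XZ] : exists Z, step (X \o clamp) Z by apply: ex_step => t _; exact: Xc.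
have ZX t : a <= t <= b -> Z t = X t.
  move=> tab; apply/eqP; rewrite -subr_eq0 -normr_le0.
  (* Both functions are close to the iterate of rank k + 1: Z by contraction, X by the rate of
     convergence. *)
  have : 2 * C * 2^-1 ^+ k / 2 + 2 * C * 2^-1 ^+ k.+1 @[k --> \oo] --> (0 : R).
    rewrite -[X in _ --> X]addr0; apply: cvgD.
      rewrite -[X in _ --> X](mul0r 2^-1); apply: cvgMl; exact: geo.
    by rewrite (cvg_shiftS (fun k => 2 * C * 2^-1 ^+ k)).
  move=> /cvgr_to_ge; apply; near=> k.
  rewrite -(subrKA (Y k.+1 t)) (le_trans (ler_normD _ _))// lerD//; last first.
    by rewrite distrC XY.
  apply: (step_contract XZ (YS k)) => // [|s sab].
    by apply: mulr_ge0; [exact: mulr_ge0|rewrite exprn_ge0// invr_ge0].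
  by rewrite /= clamp_id// XY.
exists Z; split => [|t i tab]; first by case: XZ.
by have := XZ.2 t i tab; rewrite /= clamp_id// -ZX.
Unshelve. all: by end_near. Qed.

End Picard.

(** * Averages of the controls *)

Section PeriodPrimitive.
Context {R : realType} (T : R).

(* The integral of g over every interval of length T is c: sampling periods
   start at arbitrary phases. *)
Definition period_primitive (g : R -> R) (c : R) :=
  exists G : R -> R, (forall t : R, is_derive t 1 G (g t)) /\
    forall t, G (t + T) - G t = c.

Lemma period_primitive_ext g h c : g =1 h -> period_primitive g c ->
  period_primitive h c.
Proof. by move=> /funext ->. Qed.

Lemma period_primitiveD g h c d : period_primitive g c ->
  period_primitive h d -> period_primitive (fun t => g t + h t) (c + d).
Proof.
move=> [G [Gd Gc]] [H [Hd Hc]]; exists (G + H); split => t.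
  exact: is_deriveD.
by rewrite -(Gc t) -(Hc t) !fctE; ring.
Qed.

Lemma period_primitiveZ a g c : period_primitive g c ->
  period_primitive (fun t => a * g t) (a * c).
Proof.
move=> [G [Gd Gc]]; exists (a \*: G); split => t; first exact: is_deriveZ.
by rewrite -(Gc t) /= -mulrBr.
Qed.

Lemma period_primitive_cst a : period_primitive (fun=> a) (a * T).
Proof.
exists (a \*: id); split => t; last by rewrite /= -mulrBr addrAC subrr add0r.
have := is_deriveZ a (is_derive_id t 1).
by rewrite [X in is_derive _ _ _ X]mulr1.
Qed.

Lemma period_primitive_sum (I : Type) (r : seq I) (g : I -> R -> R) (c : I -> R) :
  (forall i, period_primitive (g i) (c i)) ->
  period_primitive (fun t => \sum_(i <- r) g i t) (\sum_(i <- r) c i).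
Proof.
move=> gc; elim: r => [|i r ih].
  rewrite big_nil -[X in period_primitive _ X](mul0r T).
  by apply: period_primitive_ext (period_primitive_cst 0) => t; rewrite big_nil.
rewrite big_cons; apply: period_primitive_ext (period_primitiveD (gc i) ih) => t.
by rewrite big_cons.
Qed.
End PeriodPrimitive.

(** * Mean values of products of sines and cosines *)

Section Trigonometric.
Context {R : realType} (T : R).
Hypothesis T0 : 0 < T.
Let om : R := 2 * pi / T.

Lemma cosD2pi_int (z : int) (x : R) : cos (x + z%:~R * (2 * pi)) = cos x.
Proof.
have H (k : nat) (y : R) : cos (y + k%:R * (2 * pi)) = cos y.
  by rewrite -[RHS](periodicn (@cosD2pi R) k); congr (cos (_ + _)); ring.
case: z => k; first exact: H.
rewrite NegzE -[LHS](H k.+1) mulrNz; congr cos.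
by rewrite -addrA -mulrDl addNr mul0r addr0.
Qed.

Lemma sinD2pi_int (z : int) (x : R) : sin (x + z%:~R * (2 * pi)) = sin x.
Proof. by rewrite -!cosBpihalf addrAC cosD2pi_int. Qed.

Let omP (z : int) t : z%:~R * om * (t + T) = z%:~R * om * t + z%:~R * (2 * pi).
Proof. by rewrite mulrDr /om; congr (_ + _); field; rewrite gt_eqF. Qed.

Lemma om_gt0 : 0 < om.
Proof. by rewrite divr_gt0// mulr_gt0// pi_gt0. Qed.

Lemma is_derive_cos_lin (w t : R) :
  is_derive t 1 (fun s => cos (w * s)) (- (w * sin (w * t))).
Proof.
have := @is_derive1_comp R cos (fun s => w * s) t _ _
  (is_derive_cos (w * t)) (is_deriveZ w (is_derive_id t 1)).
move=> h; apply: (is_derive_eq h); rewrite [X in _ * X]mulr1; ring.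
Qed.

Lemma is_derive_sin_lin (w t : R) :
  is_derive t 1 (fun s => sin (w * s)) (w * cos (w * t)).
Proof.
have := @is_derive1_comp R sin (fun s => w * s) t _ _
  (is_derive_sin (w * t)) (is_deriveZ w (is_derive_id t 1)).
move=> h; apply: (is_derive_eq h); rewrite [X in _ * X]mulr1; ring.
Qed.

(** Frequencies are integers of either sign because a product of two modes produces the difference p
    - q. *)
Lemma period_primitive_cos (z : int) :
  period_primitive T (fun t => cos (z%:~R * om * t)) (if z == 0 then T else 0).
Proof.
case: eqP => [->|/eqP z0].
  have := period_primitive_cst T 1; rewrite mul1r.
  by apply: period_primitive_ext => t; rewrite !mul0r cos0.
have w0 : z%:~R * om != 0 by rewrite mulf_neq0 ?intr_eq0// gt_eqF ?om_gt0.
exists (fun t => (z%:~R * om)^-1 * sin (z%:~R * om * t)); split => t; last first.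
  by rewrite omP sinD2pi_int subrr.
have := is_deriveZ (z%:~R * om)^-1 (is_derive_sin_lin (z%:~R * om) t).
move=> h; apply: (is_derive_eq h); exact: mulKf.
Qed.

Lemma period_primitive_sin (z : int) :
  period_primitive T (fun t => sin (z%:~R * om * t)) 0.
Proof.
have [->|z0] := eqVneq z 0.
  have := period_primitive_cst T 0; rewrite mul0r.
  by apply: period_primitive_ext => t; rewrite !mul0r sin0.
have w0 : z%:~R * om != 0 by rewrite mulf_neq0 ?intr_eq0// gt_eqF ?om_gt0.
exists (fun t => - (z%:~R * om)^-1 * cos (z%:~R * om * t)); split => t; last first.
  by rewrite omP cosD2pi_int subrr.
have := is_deriveZ (- (z%:~R * om)^-1) (is_derive_cos_lin (z%:~R * om) t).
move=> h; apply: (is_derive_eq h); rewrite [LHS]mulrNN; exact: mulKf.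
Qed.

Variables (p q : nat).
Hypothesis p0 : (0 < p)%N.
Let pD : (p%:Z + q%:Z == 0) = false. Proof. by apply/negbTE; lia. Qed.
Let pB : (p%:Z - q%:Z == 0) = (p == q). Proof. by apply/idP/idP; lia. Qed.
Let zD t : (p%:Z + q%:Z)%:~R * om * t = p%:R * om * t + q%:R * om * t.
Proof. by rewrite intrD /=; ring. Qed.
Let zB t : (p%:Z - q%:Z)%:~R * om * t = p%:R * om * t - q%:R * om * t.
Proof. by rewrite intrB /=; ring. Qed.

(** Product-to-sum formulas, here and in the next two lemmas: [p0] makes p + q nonzero, so a mean
    can survive only through p - q = 0. *)
Lemma period_primitive_cos_cos :
  period_primitive T (fun t => cos (p%:R * om * t) * cos (q%:R * om * t))
    (if p == q then T / 2 else 0).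
Proof.
have := period_primitiveZ 2^-1 (period_primitiveD
  (period_primitive_cos (p%:Z + q%:Z)) (period_primitive_cos (p%:Z - q%:Z))).
rewrite pD pB.
rewrite (_ : 2^-1 * _ = if p == q then T / 2 else 0); last by case: ifP => _; field.
by apply: period_primitive_ext => t; rewrite zD zB cosB cosD; field.
Qed.

Lemma period_primitive_sin_sin :
  period_primitive T (fun t => sin (p%:R * om * t) * sin (q%:R * om * t))
    (if p == q then T / 2 else 0).
Proof.
have := period_primitiveZ 2^-1 (period_primitiveD
  (period_primitive_cos (p%:Z - q%:Z))
  (period_primitiveZ (-1) (period_primitive_cos (p%:Z + q%:Z)))).
rewrite pD pB.
rewrite (_ : 2^-1 * _ = if p == q then T / 2 else 0); last by case: ifP => _; field.
by apply: period_primitive_ext => t; rewrite zD zB cosB cosD; field.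
Qed.

Lemma period_primitive_sin_cos :
  period_primitive T (fun t => sin (p%:R * om * t) * cos (q%:R * om * t)) 0.
Proof.
have := period_primitiveZ 2^-1 (period_primitiveD
  (period_primitive_sin (p%:Z + q%:Z)) (period_primitive_sin (p%:Z - q%:Z))).
rewrite addr0 mulr0.
by apply: period_primitive_ext => t; rewrite zD zB sinB sinD; field.
Qed.
End Trigonometric.

Section Orthogonality.
Context {R : realType} (T : R) (I : finType) (kap : I -> nat).
Hypothesis T0 : 0 < T.
Hypothesis kap0 : forall i, (0 < kap i)%N.
Hypothesis kap_inj : injective kap.
Let th i (t : R) : R := (kap i)%:R * (2 * pi / T) * t.

(** The second factor has the shape of a primitive of an oscillation, with the frequencies absorbed
    in B. Injectivity of [kap] kills every cross term; the diagonal leaves the antisymmetric form q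
    p' - p q', the source of the brackets. *)
Lemma period_primitive_trig (A B p q p' q' : I -> R) :
  period_primitive T
    (fun t => (\sum_c A c * (p c * cos (th c t) + q c * sin (th c t))) *
              (\sum_d B d * (p' d * sin (th d t) - q' d * cos (th d t))))
    (T / 2 * \sum_c A c * B c * (q c * p' c - p c * q' c)).
Proof.
have H c d : period_primitive T
    (fun t => (A c * (p c * cos (th c t) + q c * sin (th c t))) *
              (B d * (p' d * sin (th d t) - q' d * cos (th d t))))
    (A c * B d * (if c == d then T / 2 * (q c * p' d - p c * q' d) else 0)).
  have cc := period_primitive_cos_cos T0 (kap d) (kap0 c).
  have ss := period_primitive_sin_sin T0 (kap d) (kap0 c).
  have sc := period_primitive_sin_cos T0 (kap c) (kap d).
  have cs := period_primitive_sin_cos T0 (kap d) (kap c).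
  have := period_primitiveZ (A c * B d) (period_primitiveD
    (period_primitiveD (period_primitiveZ (- (p c * q' d)) cc)
                       (period_primitiveZ (q c * p' d) ss))
    (period_primitiveD (period_primitiveZ (- (q c * q' d)) sc)
                       (period_primitiveZ (p c * p' d) cs))).
  rewrite (inj_eq kap_inj).
  rewrite (_ : _ + (_ + _) = if c == d then T / 2 * (q c * p' d - p c * q' d) else 0);
    last by case: ifP => _; ring.
  by apply: period_primitive_ext => t; rewrite /th; ring.
have := period_primitive_sum (index_enum I)
  (fun c => period_primitive_sum (index_enum I) (H c)).
rewrite (_ : \sum_(i <- _) _ = T / 2 * \sum_c A c * B c * (q c * p' c - p c * q' c)).
  apply: period_primitive_ext => t; rewrite mulr_suml; apply: eq_bigr => c _.
  by rewrite mulr_sumr.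
rewrite mulr_sumr; apply: eq_bigr => c _.
rewrite (bigD1 c)//= eqxx big1 ?addr0; first by ring.
by move=> d; rewrite eq_sym => /negbTE ->; rewrite mulr0.
Qed.
End Orthogonality.

(** * Drift and oscillating part of the controls *)

Section Controls.
Context {R : realType} (n m : nat).
Variables (S1 : {set 'I_m}) (S2 : {set 'I_m * 'I_m}).
Hypothesis hn : (#|S1| + #|S2|)%N = n.
Variables (kappa : 'I_m * 'I_m -> nat) (eps : R).
Hypothesis kappa_gt0 : forall j, j \in S2 -> (0 < kappa j)%N.
Hypothesis kappa_inj : {in S2 &, injective kappa}.
Hypothesis eps0 : 0 < eps.
Implicit Types (a : 'cV[R]_n) (k l : 'I_m) (t : R).

Definition drift a k : R :=
  \sum_(c < #|S1|) Defs.coef1 hn a c * (k == enum_val c)%:R.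

Let kap (c : 'I_#|S2|) := kappa (enum_val c).
Let theta c t : R := (kap c)%:R * (2 * pi / eps) * t.
Let amp a c : R :=
  (Num.sqrt eps)^-1 * (Num.sqrt `|coef2 hn a c| * (2 * Num.sqrt (pi * (kap c)%:R))).
Let cosw a k (c : 'I_#|S2|) : R := (k == (enum_val c).1)%:R * Num.sg (coef2 hn a c).
Let sinw k (c : 'I_#|S2|) : R := (k == (enum_val c).2)%:R.

Definition osc a k t : R :=
  \sum_c amp a c * (cosw a k c * cos (theta c t) + sinw k c * sin (theta c t)).

Definition osc_primitive a k t : R :=
  \sum_c amp a c / ((kap c)%:R * (2 * pi / eps)) *
    (cosw a k c * sin (theta c t) - sinw k c * cos (theta c t)).

(** Each summand counts the amplitude 2 sqrt(pi kappa) twice, for the cosine and for the sine. *)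
Definition osc_bound : R := \sum_(c < #|S2|) 4 * Num.sqrt (pi * (kap c)%:R).

Lemma osc_bound_ge0 : 0 <= osc_bound.
Proof. by apply: sumr_ge0 => c _; rewrite mulr_ge0// sqrtr_ge0. Qed.

Lemma control_split a k t : control hn kappa eps a k t = drift a k + osc a k t.
Proof.
congr (_ + _); rewrite mulr_sumr; apply: eq_bigr => c _.
rewrite /oscillation /amp /cosw /sinw.
have -> : 2 * pi * (kappa (enum_val c))%:R * t / eps = theta c t.
  by rewrite /theta /kap; ring.
by rewrite /kap; ring.
Qed.

Lemma coef_le a c : `|coef2 hn a c| <= `|a|.
Proof. exact: coord_le_norm. Qed.

Lemma drift_le a k : `|drift a k| <= n%:R * `|a|.
Proof.
rewrite (le_trans (ler_norm_sum _ _ _))//.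
apply: (@le_trans _ _ (\sum_(c < #|S1|) `|a|)).
  apply: ler_sum => c _; rewrite normrM -[leRHS]mulr1 ler_pM//.
    exact: coord_le_norm.
  by case: eqP => _; rewrite ?normr1 ?normr0.
rewrite sumr_const card_ord -[leLHS]mulr_natl ler_wpM2r// ler_nat.
by rewrite -[X in (_ <= X)%N]hn leq_addr.
Qed.

Lemma osc_le a k t : `|osc a k t| <= osc_bound * (Num.sqrt `|a| / Num.sqrt eps).
Proof.
rewrite (le_trans (ler_norm_sum _ _ _))// mulr_suml.
apply: ler_sum => c _; rewrite normrM.
have amp0 : 0 <= amp a c.
  by rewrite !mulr_ge0 ?invr_ge0 ?sqrtr_ge0.
rewrite (ger0_norm amp0).
have -> : 4 * Num.sqrt (pi * (kap c)%:R) * (Num.sqrt `|a| / Num.sqrt eps) =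
   (Num.sqrt eps)^-1 * (Num.sqrt `|a| * (2 * Num.sqrt (pi * (kap c)%:R))) * 2 :> R by ring.
have b01 (b : bool) : `|b%:R| <= 1 :> R by case: b; rewrite ?normr1 ?normr0.
rewrite ler_pM//.
  rewrite ler_wpM2l ?invr_ge0 ?sqrtr_ge0// ler_wpM2r ?mulr_ge0 ?sqrtr_ge0//.
  by rewrite ler_wsqrtr// coef_le.
rewrite (le_trans (ler_normD _ _))// !normrM -[2]/(1 + 1) lerD//.
  rewrite mulr_ile1 ?mulr_ge0 ?cos_max// mulr_ile1//.
  by rewrite normr_sg; case: eqP.
by apply: mulr_ile1 => //; [exact: b01|exact: sin_max].
Qed.

Let kap_neq0 c : (kap c)%:R != 0 :> R.
Proof. by rewrite pnatr_eq0 -lt0n kappa_gt0// enum_valP. Qed.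

Let pi_neq0 : pi != 0 :> R. Proof. by rewrite gt_eqF// pi_gt0. Qed.

Lemma is_derive_osc_primitive a k t :
  is_derive t 1 (osc_primitive a k) (osc a k t).
Proof.
pose h (c : 'I_#|S2|) (s : R) : R := amp a c / ((kap c)%:R * (2 * pi / eps)) *
    (cosw a k c * sin (theta c s) - sinw k c * cos (theta c s)).
rewrite (_ : osc_primitive a k = \sum_c h c); last first.
  by apply/funext => s; rewrite fct_sumE.
apply: is_derive_sum => c; rewrite /h.
have ds := is_derive_sin_lin ((kap c)%:R * (2 * pi / eps)) t.
have dc := is_derive_cos_lin ((kap c)%:R * (2 * pi / eps)) t.
have H := is_deriveZ (amp a c / ((kap c)%:R * (2 * pi / eps)))
  (is_deriveB (is_deriveZ (cosw a k c) ds) (is_deriveZ (sinw k c) dc)).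
apply: (is_derive_eq H).
rewrite -[LHS]/(amp a c / ((kap c)%:R * (2 * pi / eps)) *
  (cosw a k c * ((kap c)%:R * (2 * pi / eps) * cos (theta c t)) -
   sinw k c * - ((kap c)%:R * (2 * pi / eps) * sin (theta c t)))).
have w0 : 2 * pi / eps != 0 :> R by rewrite !mulf_neq0 ?invr_eq0 ?pi_neq0 ?pnatr_eq0// gt_eqF.
have := kap_neq0 c; move: (kap c)%:R (2 * pi / eps) w0 => K w w0 K0.
by field; rewrite w0 K0.
Qed.

Lemma osc_primitive_period a k t :
  osc_primitive a k (t + eps) = osc_primitive a k t.
Proof.
apply: eq_bigr => c _.
have -> : theta c (t + eps) = theta c t + (kap c)%:Z%:~R * (2 * pi).
  by rewrite /theta; field; rewrite gt_eqF.
by rewrite cosD2pi_int sinD2pi_int.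
Qed.

(** This is what the normalisation 2 sqrt(pi kappa) is made for: the squared amplitude 4 pi kappa
    |a_j| / eps, divided by the angular frequency 2 pi kappa / eps and multiplied by the half period
    eps / 2, is eps |a_j|, and the sign carried by the cosine turns |a_j| into a_j. *)
Lemma osc_period_primitive a k l :
  period_primitive eps (fun t => osc a k t * osc_primitive a l t)
   (eps * \sum_(c < #|S2|) coef2 hn a c *
      ((k == (enum_val c).2)%:R * (l == (enum_val c).1)%:R -
       (k == (enum_val c).1)%:R * (l == (enum_val c).2)%:R)).
Proof.
have kap0 c : (0 < kap c)%N by apply/kappa_gt0/enum_valP.
have kap_inj : injective kap.
  by move=> c d /(kappa_inj (enum_valP _) (enum_valP _)) /enum_val_inj.
have := period_primitive_trig eps0 kap0 kap_inj (amp a)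
  (fun c => amp a c / ((kap c)%:R * (2 * pi / eps)))
  (cosw a k) (sinw k) (cosw a l) (sinw l).
congr period_primitive; rewrite !mulr_sumr; apply: eq_bigr => c _.
have e0 : eps != 0 by rewrite gt_eqF.
have amp2 : amp a c * amp a c = `|coef2 hn a c| * (4 * (pi * (kap c)%:R)) / eps.
  rewrite -expr2 /amp !exprMn exprVn !sqr_sqrtr ?(ltW eps0)//.
    by move: (pi : R) => p; field.
  by rewrite mulr_ge0// pi_ge0.
rewrite [X in _ = _ * (X * _)](numEsg (coef2 hn a c)).
rewrite [amp a c * (_ / _)]mulrA amp2 /cosw /sinw.
have := kap_neq0 c; move: (kap c)%:R (pi : R) pi_neq0 => K p p0 K0.
by field; rewrite K0 p0 e0.
Qed.

Lemma osc_continuous a k : continuous (osc a k).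
Proof.
move=> t; apply/differentiable_continuous/derivable1_diffP.
rewrite (_ : osc a k = \sum_c (fun s => amp a c *
    (cosw a k c * cos (theta c s) + sinw k c * sin (theta c s)))); last first.
  by apply/funext => s; rewrite fct_sumE.
apply: derivable_sum => c; apply: derivableZ; apply: derivableD; apply: derivableZ.
  by case: (is_derive_cos_lin ((kap c)%:R * (2 * pi / eps)) t).
by case: (is_derive_sin_lin ((kap c)%:R * (2 * pi / eps)) t).
Qed.

Section Fields.
Variable f : 'I_m -> 'cV[R]_n -> 'cV[R]_n.

Lemma sum_drift a x : \sum_k drift a k *: f k x =
  \sum_(c < #|S1|) Defs.coef1 hn a c *: f (enum_val c) x.
Proof.
under eq_bigr do rewrite scaler_suml.
rewrite exchange_big/=; apply: eq_bigr => c _.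
rewrite (bigD1 (enum_val c))//= eqxx mulr1 big1 ?addr0// => k /negbTE ->.
by rewrite mulr0 scale0r.
Qed.

(** The antisymmetric weights select the derivative of the second field of the pair along the first,
    minus the reverse, in the sign convention of [lie_bracket]. *)
Lemma sum_bracket a x : (forall k, differentiable (f k) x) ->
  \sum_k \sum_l (\sum_(c < #|S2|) coef2 hn a c *
      ((k == (enum_val c).2)%:R * (l == (enum_val c).1)%:R -
       (k == (enum_val c).1)%:R * (l == (enum_val c).2)%:R)) *:
    'D_(f l x) (f k) x =
  \sum_(c < #|S2|) coef2 hn a c *:
    lie_bracket (f (enum_val c).1) (f (enum_val c).2) x.
Proof.
move=> fd.
under eq_bigr do (under eq_bigr do rewrite scaler_suml; rewrite exchange_big/=).
rewrite exchange_big/=; apply: eq_bigr => c _.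
have H i j : \sum_k \sum_l ((k == i)%:R * (l == j)%:R) *: 'D_(f l x) (f k) x =
    'D_(f j x) (f i) x.
  rewrite (bigD1 i)//= (bigD1 j)//= !eqxx mulr1 scale1r.
  rewrite big1 ?addr0 => [|l /negbTE ->]; last by rewrite mulr0 scale0r.
  rewrite big1 ?addr0// => k /negbTE ki; apply: big1 => l _.
  by rewrite ki mul0r scale0r.
under eq_bigr do (under eq_bigr do rewrite -scalerA scalerBl; rewrite -scaler_sumr sumrB).
by rewrite -scaler_sumr sumrB !H /lie_bracket /lie_deriv !deriveE.
Qed.
End Fields.
End Controls.

(** * Expansion over one period *)

Section Confinement.
Context {R : realType}.

Lemma within_itv_continuousP (V : normedModType R) (g : R -> V) a b t e :
  {within `[a, b], continuous g} -> a <= t <= b -> 0 < e ->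
  exists2 d : R, 0 < d &
    forall s, a <= s <= b -> `|t - s| < d -> `|g t - g s| < e.
Proof.
move=> /subspace_continuousP gc tab e0.
have /gc/cvgrPdist_lt/(_ e e0) : `[a, b]%classic t by rewrite /= in_itv.
rewrite near_withinE => /nbhs_ballP[d /= d0 dP]; exists d => // s sab ts.
by apply: dP; [rewrite -ball_normE|rewrite /= in_itv].
Qed.

(* First-exit argument: the infimum of the exit times would not be one. *)
Lemma confinement (phi : R -> R) a b rho : {within `[a, b], continuous (phi : R -> R^o)} ->
  (forall t, a <= t <= b -> (forall s, a <= s < t -> phi s < rho) -> phi t < rho) ->
  forall t, a <= t <= b -> phi t < rho.
Proof.
move=> phic step t1 /andP[at1 t1b]; apply: contrapT => /negP; rewrite -leNgt => ht1.
pose E := [set t | a <= t <= t1 /\ rho <= phi t].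
have Et1 : E t1 by split => //; rewrite at1 lexx.
have hE : has_inf E by split; [exists t1|exists a => t [/andP[]]].
have infE : lbound E (inf E) by move=> x Ex; apply: ge_inf => //; case: hE.
have ta : a <= inf E by apply: lb_le_inf; [exists t1|move=> t [/andP[]]].
have tt1 : inf E <= t1 by exact: infE.
have tab : a <= inf E <= b by rewrite ta (le_trans tt1).
have before s : a <= s < inf E -> phi s < rho.
  move=> /andP[as_ sE]; rewrite ltNge; apply/negP => hs.
  have : inf E <= s by apply: infE; split => //; rewrite as_ (le_trans (ltW sE)).
  by rewrite leNgt sE.
have hphi := step _ tab before.
have [d d0 dP] := within_itv_continuousP phic tab (eq_ind_r is_true hphi (subr_gt0 _ _)).
have [t [/andP[at_ tt1'] ht] td] := inf_adherent d0 hE.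
have tE : inf E <= t by apply: infE; split => //; rewrite at_.
have := dP t; rewrite at_ (le_trans tt1')//= distrC ger0_norm ?subr_ge0//.
move=> /(_ isT); rewrite ltrBlDl => /(_ td); rewrite ltr_norml => /andP[+ _].
rewrite ltrBrDr; lra.
Qed.
End Confinement.

Section OnePeriod.
Context {R : realType} (n m : nat).
Variables (f : 'I_m -> 'cV[R]_n -> 'cV[R]_n) (c : 'cV[R]_n) (r K C : R).
Let B := [set x : 'cV[R]_n | `|x - c| <= r].
Hypothesis K0 : 0 <= K.
Hypothesis C0 : 0 <= C.
Hypothesis f_diff : forall k x, B x -> differentiable (f k) x.
Hypothesis f_le : forall k x, B x -> `|f k x| <= K.
Hypothesis f_lip : forall k x y, B x -> B y -> `|f k x - f k y| <= K * `|x - y|.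
Hypothesis df_le : forall k x v, B x -> `|'D_v (f k) x| <= K * `|v|.
Hypothesis f_taylor : forall k x y, B x -> B y ->
  `|f k x - f k y - 'D_(x - y) (f k) y| <= K * `|x - y| ^+ 2.

(* The k-th control is v k + w k; h is the order of its integral over a period. *)
Variables (eps h a : R) (v : 'I_m -> R) (w W : 'I_m -> R -> R) (Q : 'I_m -> 'I_m -> R).
Hypothesis eps0 : 0 < eps.
Hypothesis h0 : 0 <= h.
Hypothesis v_le : forall k, `|v k| <= C * h ^+ 2 / eps.
Hypothesis w_le : forall k t, `|w k t| <= C * h / eps.
Hypothesis u_le : forall k t, `|v k + w k t| <= C * h / eps.
Hypothesis W_der : forall k (t : R), is_derive t 1 (W k) (w k t).
Hypothesis W_per : forall k t, W k (t + eps) = W k t.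
Hypothesis wW : forall k l, period_primitive eps (fun t => w k t * W l t) (Q k l).
Let b := a + eps.

Variables (x : R -> 'cV[R]_n) (rho : R).
Hypothesis x_prim : primitive_on a b x (fun t => \sum_k (v k + w k t) *: f k (x t)).
Hypothesis rho_lt : m%:R * K * C * h < rho.
Hypothesis xa_ball : `|x a - c| + rho <= r.

Let ab : a <= b. Proof. by rewrite lerDl ltW. Qed.

Lemma sum_norm_le (V : normedModType R) (F : 'I_m -> V) (L : R) :
  (forall k, `|F k| <= L) -> `|\sum_k F k| <= m%:R * L.
Proof.
move=> FL; rewrite (le_trans (ler_norm_sum _ _ _))//.
rewrite (le_trans (ler_sum _ (fun k _ => FL k)))//.
by rewrite sumr_const card_ord -[leLHS]mulr_natl.
Qed.

(** Conditional on staying in the ball, where alone the fields are bounded. As the resulting bound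
    is strictly below [rho], [confinement] then discharges the condition. *)
Lemma period_displacement_sub t : a <= t <= b ->
  (forall s, a < s < t -> B (x s)) -> `|x t - x a| <= m%:R * K * C * h.
Proof.
move=> /andP[at_ tb] xB.
have M0 : 0 <= m%:R * (C * h / eps * K) by rewrite !mulr_ge0// invr_ge0 ltW.
have := mean_value_col at_ M0 (primitive_on_sub (lexx a) tb x_prim).
move=> H; apply: (le_trans (H _)).
  move=> s; rewrite in_itv/= => sat; apply: sum_norm_le => k.
  by rewrite normrZ ler_pM//; exact/f_le/xB.
apply: (@le_trans _ _ (m%:R * (C * h / eps * K) * eps)).
  by rewrite ler_wpM2l// lerBlDl.
by rewrite le_eqVlt; apply/orP; left; apply/eqP; field; rewrite gt_eqF.
Qed.

Lemma period_lt_rho t : a <= t <= b -> `|x t - x a| < rho.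
Proof.
have xc : {within `[a, b], continuous (fun t => `|x t - x a| : R^o)}.
  move=> s; apply: cvg_norm; apply: cvgB; last exact: cvg_cst.
  exact: primitive_on_continuous x_prim s.
move: t; apply: (confinement xc) => t tab ht.
apply: le_lt_trans rho_lt; apply: period_displacement_sub => // s /andP[as_ st].
rewrite /B /= -(subrKA (x a)) (le_trans (ler_normD _ _))//.
by rewrite (le_trans _ xa_ball)// addrC lerD2l ltW// ht// (ltW as_).
Qed.

Lemma period_ball t : a <= t <= b -> B (x t).
Proof.
move=> tab; rewrite /B /= -(subrKA (x a)) (le_trans (ler_normD _ _))//.
by rewrite (le_trans _ xa_ball)// addrC lerD2l ltW// period_lt_rho.
Qed.

Lemma period_displacement t : a <= t <= b -> `|x t - x a| <= m%:R * K * C * h.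
Proof.
move=> /andP[at_ tb]; apply: period_displacement_sub; first by rewrite at_.
move=> s /andP[as_ st]; apply: period_ball.
by rewrite (ltW as_) (le_trans (ltW st)).
Qed.
(* U k is the integral of the k-th control, y the remainder of the first-order
   expansion of x. *)
Let U k t := v k * (t - a) + (W k t - W k a).
Let y t := x t - x a - \sum_k U k t *: f k (x a).
Let a_itv : a <= a <= b. Proof. by rewrite lexx. Qed.

Let U_der k (t : R) : is_derive t 1 (U k) (v k + w k t).
Proof.
have := is_deriveD (is_deriveZ (v k) (is_deriveB (is_derive_id t 1) (is_derive_cst a t 1)))
  (is_deriveB (W_der k t) (is_derive_cst (W k a) t 1)).
move=> H; apply: (is_derive_eq H).
by rewrite !subr0 [X in X + _]mulr1.
Qed.

Let itv_len t : a <= t <= b -> 0 <= t - a <= eps.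
Proof. by move=> /andP[at_ tb]; rewrite subr_ge0 at_/= lerBlDl. Qed.

Let increment_le (g dg : R -> R) L t : a <= t <= b -> 0 <= L ->
  (forall s : R, is_derive s 1 g (dg s)) -> (forall s, `|dg s| <= L / eps) ->
  `|g t - g a| <= L.
Proof.
move=> tab L0 gd gL; have /andP[at_ tb] := tab.
have gc : {within `[a, t], continuous g}.
  by apply: derivable_within_continuous => s _; case: (gd s).
have := mean_value_le at_ gc (fun s _ => gd s) (fun s _ => gL s).
move=> /le_trans; apply; rewrite mulrAC ler_pdivrMr// ler_wpM2l//.
by have /andP[] := itv_len tab.
Qed.

Let Ch0 : 0 <= C * h. Proof. exact: mulr_ge0. Qed.

Let U_le k t : a <= t <= b -> `|U k t| <= C * h.
Proof.
move=> tab; have := increment_le tab Ch0 (U_der k) (u_le k).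
by rewrite {2}/U !subrr mulr0 addr0 subr0.
Qed.

Let y_prim : primitive_on a b y
  (fun t => \sum_k (v k + w k t) *: (f k (x t) - f k (x a))).
Proof.
have := primitive_onB (primitive_onB x_prim (primitive_on_cst a b (x a)))
  (primitive_on_sum (index_enum _) (fun k => primitive_on_scale a b (f k (x a)) (U_der k))).
rewrite (_ : (fun t => _ - 0 - _) =
  (fun t => \sum_k (v k + w k t) *: (f k (x t) - f k (x a))))//.
apply/funext => t; rewrite subr0 -sumrB.
by apply: eq_bigr => k _; rewrite scalerBr.
Qed.

(** The fields deviate by O(h) from their initial values, and controls of size O(h / eps) act on
    this deviation during a time at most eps. *)
Let y_le t : a <= t <= b -> `|y t| <= m%:R ^+ 2 * K ^+ 2 * C ^+ 2 * h ^+ 2.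
Proof.
move=> tab; have /andP[at_ tb] := tab.
have M0 : 0 <= m%:R * (C * h / eps * (K * (m%:R * K * C * h))).
  by rewrite !mulr_ge0// invr_ge0 ltW.
have := mean_value_col at_ M0 (primitive_on_sub (lexx a) tb y_prim).
rewrite {2}/y subrr sub0r big1 => [|k _]; last first.
  by rewrite /U !subrr mulr0 addr0 scale0r.
rewrite oppr0 subr0 => H; apply: (le_trans (H _)).
  move=> s; rewrite in_itv/= => /andP[as_ st]; apply: sum_norm_le => k.
  have sab : a <= s <= b by rewrite (ltW as_) (le_trans (ltW st)).
  rewrite normrZ ler_pM//.
  apply: le_trans (f_lip k (period_ball sab) (period_ball a_itv)) _.
  by rewrite ler_wpM2l// period_displacement.
have /andP[_ te] := itv_len tab.
apply: (le_trans (ler_wpM2l M0 te)).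
by rewrite le_eqVlt; apply/orP; left; apply/eqP; field; rewrite gt_eqF.
Qed.

(** Anchoring W at the initial instant subtracts the constant [W l a] times [w k], whose integral
    over a period vanishes because [W k] is periodic: the initial phase drops out. *)
Let V_prim k l : exists G : R -> R,
  (forall t : R, is_derive t 1 G (w k t * (W l t - W l a))) /\ G b - G a = Q k l.
Proof.
have [G [Gd GQ]] := wW k l; exists (G - W l a \*: W k); split => [t|].
  have := is_deriveB (Gd t) (is_deriveZ (W l a) (W_der k t)) => H.
  by apply: (is_derive_eq H); rewrite mulrBr [X in _ - X]mulrC.
rewrite -(GQ a) -[LHS]/((G b - W l a * W k b) - (G a - W l a * W k a)) /b W_per.
by ring.
Qed.

(* The constant part v of the control is O(h^2 / eps), hence only the products
   w k * W l contribute at second order. *)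
Lemma period_expansion :
  `|x b - x a - eps *: (\sum_k v k *: f k (x a)) -
    \sum_k \sum_l Q k l *: 'D_(f l (x a)) (f k) (x a)| <=
  (m%:R * (2 * m%:R ^+ 2 * K ^+ 3 * C ^+ 3 + 2 * m%:R * C ^+ 2 * K ^+ 2)) * h ^+ 3.
Proof.
have /choice[G GP] : forall kl : 'I_m * 'I_m, exists G : R -> R,
    (forall t : R, is_derive t 1 G (w kl.1 t * (W kl.2 t - W kl.2 a))) /\
    G b - G a = Q kl.1 kl.2 by move=> [k l]; exact: V_prim.
pose d k l := 'D_(f l (x a)) (f k) (x a).
(* Here y is stripped of its second-order part; the increment of z over the period is the quantity
   to be estimated. *)
pose z t := y t - \sum_k \sum_l (G (k, l) t) *: d k l.
have z_prim : primitive_on a b z (fun t =>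
    \sum_k (v k + w k t) *: (f k (x t) - f k (x a)) -
    \sum_k \sum_l (w k t * (W l t - W l a)) *: d k l).
  apply: primitive_onB; first exact: y_prim.
  apply: primitive_on_sum => k; apply: primitive_on_sum => l.
  exact: primitive_on_scale (GP (k, l)).1.
have Bxa := period_ball a_itv.
(* The derivative of z splits into the Taylor remainder of the field, the effect of the first-order
   remainder y, and the products of controls other than w times W. Each is O(h^3 / eps), and they
   yield the three summands of the bound in this order. *)
have dzE t : \sum_k (v k + w k t) *: (f k (x t) - f k (x a)) -
    \sum_k \sum_l (w k t * (W l t - W l a)) *: d k l =
  \sum_k ((v k + w k t) *: (f k (x t) - f k (x a) - 'D_(x t - x a) (f k) (x a)) +
          (v k + w k t) *: 'D_(y t) (f k) (x a) +
          \sum_l ((v k + w k t) * U l t - w k t * (W l t - W l a)) *: d k l).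
  rewrite -sumrB; apply: eq_bigr => k _.
  have -> : \sum_l ((v k + w k t) * U l t - w k t * (W l t - W l a)) *: d k l =
      (v k + w k t) *: (\sum_l U l t *: d k l) -
      \sum_l (w k t * (W l t - W l a)) *: d k l.
    rewrite scaler_sumr -sumrB; apply: eq_bigr => l _.
    by rewrite scalerBl scalerA.
  rewrite addrA -scalerDr -scalerDr; congr (_ *: _ - _).
  have fd := f_diff k Bxa.
  have -> : \sum_l U l t *: d k l = 'D_(x t - x a - y t) (f k) (x a).
    rewrite (_ : x t - x a - y t = \sum_l U l t *: f l (x a)); last first.
      by rewrite /y opprB addrC subrK.
    rewrite deriveE// linear_sum/=; apply: eq_bigr => l _.
    by rewrite linearZ/= -deriveE.
  have -> : 'D_(x t - x a - y t) (f k) (x a) =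
      'D_(x t - x a) (f k) (x a) - 'D_(y t) (f k) (x a).
    by rewrite !(deriveE _ fd); exact: linearB.
  move: (f k (x t) - f k (x a)) ('D_(x t - x a) (f k) (x a)) ('D_(y t) (f k) (x a)).
  by move=> p q s; rewrite addrA (addrAC _ s) subrK addrK.
have M0 : 0 <= m%:R * (C * h / eps * (K * (m%:R * K * C * h) ^+ 2) +
   C * h / eps * (K * (m%:R ^+ 2 * K ^+ 2 * C ^+ 2 * h ^+ 2)) +
   m%:R * (2 * C ^+ 2 * h ^+ 3 / eps * (K * K))).
  by rewrite !(mulr_ge0, addr_ge0, exprn_ge0, invr_ge0)// ltW.
have := mean_value_col ab M0 z_prim => H.
have zb : z b - z a = x b - x a - eps *: (\sum_k v k *: f k (x a)) -
    \sum_k \sum_l Q k l *: d k l.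
  have -> : \sum_k \sum_l Q k l *: d k l = \sum_k \sum_l (G (k, l) b) *: d k l -
      \sum_k \sum_l (G (k, l) a) *: d k l.
    rewrite -sumrB; apply: eq_bigr => k _; rewrite -sumrB; apply: eq_bigr => l _.
    by rewrite -scalerBl (GP (k, l)).2.
  have -> : eps *: (\sum_k v k *: f k (x a)) = \sum_k U k b *: f k (x a).
    rewrite scaler_sumr; apply: eq_bigr => k _.
    by rewrite scalerA /U /b W_per subrr addr0 addrAC subrr add0r mulrC.
  have ya : y a = 0.
    rewrite /y subrr sub0r big1 ?oppr0// => k _.
    by rewrite /U !subrr mulr0 addr0 scale0r.
  by rewrite /z ya sub0r opprK opprB addrAC -addrA.
rewrite -zb; apply: (le_trans (H _)); last first.
  have -> : b - a = eps by rewrite /b addrAC subrr add0r.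
  by rewrite le_eqVlt; apply/orP; left; apply/eqP; field; rewrite gt_eqF.
move=> t; rewrite in_itv/= => /andP[at_ tb].
have tab : a <= t <= b by rewrite !ltW.
rewrite dzE; apply: sum_norm_le => k.
apply: le_trans (ler_normD _ _) _; apply: lerD.
  apply: le_trans (ler_normD _ _) _; apply: lerD.
    rewrite normrZ ler_pM//.
    apply: le_trans (f_taylor k (period_ball tab) Bxa) _.
    by rewrite ler_wpM2l// ler_sqr ?nnegrE ?mulr_ge0// period_displacement.
  rewrite normrZ ler_pM//; apply: le_trans (df_le k _ Bxa) _.
  by rewrite ler_wpM2l// y_le.
apply: sum_norm_le => l; rewrite normrZ ler_pM//; last first.
  by apply: le_trans (df_le k _ Bxa) _; rewrite ler_wpM2l// f_le.
(* After the cancellation every product contains a constant part v, which gains one power of h. *)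
have -> : (v k + w k t) * U l t - w k t * (W l t - W l a) =
    v k * U l t + w k t * (v l * (t - a)) by rewrite /U; ring.
apply: le_trans (ler_normD _ _) _.
have -> : 2 * C ^+ 2 * h ^+ 3 / eps = C * h ^+ 2 / eps * (C * h) +
    C * h / eps * (C * h ^+ 2 / eps * eps) by field; rewrite gt_eqF.
rewrite !normrM lerD ?ler_pM ?mulr_ge0 ?U_le//.
by have /andP[ta0 te] := itv_len tab; rewrite ger0_norm.
Qed.
End OnePeriod.

(** * Solutions in the sense of sampling *)

Section DerivativeWithin.
Context {R : realType} (n : nat).
Implicit Types (x : R -> 'cV[R]_n) (v : 'cV[R]_n).

Lemma is_derive_quotientP x (t : R) v :
  is_derive t 1 x v <-> (s - t)^-1 *: (x s - x t) @[s --> t^'] --> v.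
Proof.
split=> [[xd xv]|xv].
  have /cvgrPdist_lt H : h^-1 *: (x (h *: 1 + t) - x t) @[h --> (0 : R)^'] --> v.
    by rewrite -xv; exact: xd.
  apply/cvgrPdist_lt => e /H /nbhs_ballP[d /= d0 dP]; apply/nbhs_ballP.
  exists d => // s /= ts sneqt.
  have := dP (s - t); rewrite /= subr_eq0 [_ *: 1]mulr1 subrK; apply => //.
  by move: ts; rewrite -!ball_normE /= sub0r normrN distrC.
have H : h^-1 *: (x (h *: 1 + t) - x t) @[h --> (0 : R)^'] --> v.
  apply/cvgrPdist_lt => e e0; move/cvgrPdist_lt/(_ e e0) : xv.
  move=> /nbhs_ballP[d /= d0 dP]; apply/nbhs_ballP; exists d => // h /= h0 hneq.
  have := dP (h *: 1 + t); rewrite /= [_ *: 1]mulr1 addrK; apply.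
    by move: h0; rewrite -!ball_normE /= sub0r normrN opprD addrCA subrr addr0 normrN.
  by rewrite -subr_eq0 addrK.
by split; [apply/cvg_ex; exists v|exact: cvg_lim].
Qed.

Lemma is_derive_cols x (t : R) v :
  (forall i, is_derive t 1 (fun s => x s i 0) (v i 0)) -> is_derive t 1 x v.
Proof.
move=> xv; have xd : derivable x t 1.
  by apply/derivable_mxP => i j; rewrite ord1; case: (xv i).
split => //; rewrite derive_mx//; apply/colP => i; rewrite mxE.
by case: (xv i).
Qed.

Lemma has_deriv_within_interior x (p q t : R) v : t \in `]p, q[ ->
  has_deriv_within `[p, q[%classic x t v -> is_derive t 1 x v.
Proof.
move=> tpq xv; apply/is_derive_quotientP.
apply/cvgrPdist_lt => e e0; move/cvgrPdist_lt/(_ e e0) : xv.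
rewrite near_withinE => H.
have tI : \forall s \near t^', s \in `]p, q[.
  by apply: (@cvg_within _ (nbhs t)); exact: near_in_itvoo.
apply: filterS2 H tI => s + spq; apply.
by rewrite /= (subset_itv_oo_co spq).
Qed.

Lemma has_deriv_within_eq x y (I : set R) (t : R) v : I t ->
  (forall s, I s -> x s = y s) -> is_derive t 1 y v -> has_deriv_within I x t v.
Proof.
move=> It xy /is_derive_quotientP yv.
apply/cvgrPdist_lt => e e0; move/cvgrPdist_lt/(_ e e0) : yv => H.
by rewrite near_withinE; apply: filterS H => s + Is; rewrite !xy.
Qed.

Lemma abs_continuous_within a b x :
  abs_continuous a b x -> {within `[a, b], continuous x}.
Proof.
move=> xac; apply/subspace_continuousP => t; rewrite /= in_itv/= => /andP[at_ tb].
apply/cvgrPdist_lt => e e0; rewrite near_withinE.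
have [d d0 dP] := xac e e0; apply/nbhs_ballP; exists d => // s.
rewrite -ball_normE /= => ts; rewrite in_itv/= => /andP[as_ sb].
have H (l r : R) : a <= l -> l <= r -> r <= b -> r - l < d -> `|x r - x l| < e.
  move=> al lr rb rl.
  have := dP 1%N (fun=> l) (fun=> r); rewrite !big_ord1 => /(_ _ _ rl) h.
  apply: le_lt_trans (norm_le_enorm _) (h _ _) => //.
  by move=> i j _ _ _; rewrite (ord1 i) (ord1 j).
have [st|/ltW st] := leP s t.
  by apply: H => //; rewrite (le_lt_trans _ ts)// ler_norm.
by rewrite distrC; apply: H => //; rewrite distrC in ts; rewrite (le_lt_trans _ ts)// ler_norm.
Qed.

Lemma lipschitz_abs_continuous a b x L : 0 <= L ->
  (forall s t, a <= s -> s <= t -> t <= b -> `|x t - x s| <= L * (t - s)) ->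
  abs_continuous a b x.
Proof.
move=> L0 xL e e0.
have M0 : 0 < n%:R * L + 1 by rewrite ltr_wpDl// mulr_ge0.
exists (e / (n%:R * L + 1)) => [|N l r lr _]; first exact: divr_gt0.
rewrite ltr_pdivlMr// => H; apply: le_lt_trans H.
rewrite mulr_suml; apply: ler_sum => i _; have [al [lri rb]] := lr i.
rewrite (le_trans (enorm_le_norm _))//.
apply: (@le_trans _ _ (n%:R * (L * (r i - l i)))).
  by rewrite ler_wpM2l// xL.
by rewrite mulrA mulrC ler_wpM2l ?subr_ge0// lerDl.
Qed.

End DerivativeWithin.

Section PiSolution.
Context {R : realType} (n m : nat) (D : set 'cV[R]_n).
Variables (f : 'I_m -> 'cV[R]_n -> 'cV[R]_n) (u : 'cV[R]_n -> 'I_m -> R -> R).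
Variables (fb : 'cV[R]_n -> 'cV[R]_n) (eps t0 : R) (x0 : 'cV[R]_n) (x : R -> 'cV[R]_n).
Hypothesis eps0 : 0 < eps.
Hypothesis sol : pi_solution D f u fb eps t0 x0 x.

(** Absolute continuity supplies continuity at the right end of the period, which the derivative
    relative to the half-open period does not see. *)
Lemma pi_solution_primitive j : let tj := t0 + eps * j%:R in
  primitive_on tj (tj + eps) x (fun t => \sum_k u (fb (x tj)) k t *: f k (x t)).
Proof.
move=> tj i; have [_ xac _ xder] := sol.
have tj0 : t0 <= tj by rewrite lerDl mulr_ge0// ltW.
have tjS : tj + eps = t0 + eps * j.+1%:R by rewrite -natr1 mulrDr mulr1 addrA.
split.
  have := xac (tj + eps); rewrite (le_trans tj0) ?lerDl ?(ltW eps0)// => /(_ isT).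
  move=> /abs_continuous_within xc.
  have {}xc : {within `[tj, tj + eps], continuous x}.
    by apply: continuous_subspaceW xc; apply: subset_itv; rewrite bnd_simp.
  by move=> t; apply: continuous_coord; exact: xc.
move=> t tI; apply: is_derive_coord.
apply: (has_deriv_within_interior tI); rewrite tjS; apply: xder => /=.
by rewrite -tjS (subset_itv_oo_co tI).
Qed.
End PiSolution.

(** * The closed loop on a ball *)

Section ClosedLoop.
Context {R : realType} (n m : nat) (D : set 'cV[R]_n).
Variables (f : 'I_m -> 'cV[R]_n -> 'cV[R]_n).
Variables (S1 : {set 'I_m}) (S2 : {set 'I_m * 'I_m}).
Hypothesis hn : (#|S1| + #|S2|)%N = n.
Variables (xs : 'cV[R]_n) (P : 'cV[R]_n -> R).
Variables (gamma r : R).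
Hypothesis r0 : 0 < r.
Let B := [set x : 'cV[R]_n | `|x - xs| <= r].
Hypothesis BD : B `<=` D.
Hypothesis f_C2 : forall k, classC 2 D (f k).
Hypothesis f_inv_bounded : forall Dt : R -> set 'cV[R]_n,
       (forall t, 0 <= t -> compact (Dt t) /\ Dt t `<=` D) ->
       exists2 MF : R, 0 < MF &
         forall t x, 0 <= t -> Dt t x -> opnorm (invmx (frame f hn x)) <= MF.
Hypothesis P_C2 : classC 2 D (P : 'cV[R]_n -> R^o).
Hypothesis grad_xs : grad P xs = 0.

(** A single constant for all estimates on the ball, so that the later smallness conditions bear on
    eps alone. *)
Record ball_estimates (K : R) : Prop := BallEstimates {
  ball_ge0 : 0 <= K;
  ball_f : forall k x, B x -> `|f k x| <= K;
  ball_f_lip : forall k x y, B x -> B y -> `|f k x - f k y| <= K * `|x - y|;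
  ball_df : forall k x v, B x -> `|'D_v (f k) x| <= K * `|v|;
  ball_f_taylor : forall k x y, B x -> B y ->
    `|f k x - f k y - 'D_(x - y) (f k) y| <= K * `|x - y| ^+ 2;
  ball_P_taylor : forall x y, B x -> B y ->
    `|P x - P y - 'D_(x - y) (P : 'cV[R]_n -> R^o) y| <= K * `|x - y| ^+ 2;
  ball_grad : forall x, B x -> `|grad P x| <= K * `|x - xs|;
  ball_feedback : forall x, B x -> `|feedback f hn P gamma x| <= K * `|grad P x| }.

Let classC21 (W : normedModType R) (g : 'cV[R]_n -> W) : classC 2 D g -> classC 1 D g.
Proof.
move=> [gd g2]; split => // v x Dx; apply: differentiable_continuous.
by have [gv _] := g2 v; exact: gv.
Qed.

(** Lipschitz continuity of the partial derivatives of P, anchored at their common zero [xs]. *)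
Lemma near_ball_grad : \forall K \near +oo%R, forall x, B x -> `|grad P x| <= K * `|x - xs|.
Proof.
have := near_derive_lipschitz (ltW r0) BD (@mean_value_space_real R) P_C2.
apply: filterS2 (nbhs_pinfty_ge (num_real 0)) => K K0 H x Bx.
have Bxs : B xs by rewrite /B /= subrr normr0 ltW.
rewrite -[grad P x]subr0 -[X in _ - X]grad_xs; apply: norm_le_coord => [|i].
  by rewrite mulr_ge0.
rewrite !mxE; apply: le_trans (H _ _ _ Bx Bxs) _.
rewrite -[leRHS]mulr1 ler_wpM2l ?mulr_ge0//.
by apply: norm_le_coord => // j; rewrite !mxE; case: eqP => _; rewrite ?normr1 ?normr0 ?ler01.
Qed.

Lemma ex_ball_estimates : exists K, ball_estimates K.
Proof.
(* The family of compact sets is taken constant in time, equal to the ball. *)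
have [MF MF0 MFP] := @f_inv_bounded (fun=> B)
  (fun _ _ => conj (compact_sup_ball (c := xs) (ltW r0)) BD).
have bf : \forall K \near +oo%R, forall k x, B x -> `|f k x| <= K.
  apply: filter_forall => k; apply: (near_ball_bounded (ltW r0) BD) => x Dx.
  by apply: differentiable_continuous; case: (f_C2 k) => + _; apply.
have bl : \forall K \near +oo%R, forall k x y, B x -> B y -> `|f k x - f k y| <= K * `|x - y|.
  apply: filter_forall => k; apply: (near_ball_lipschitz (ltW r0) BD).
    exact: mean_value_space_col.
  exact/classC21/f_C2.
have bd : \forall K \near +oo%R, forall k x v, B x -> `|'D_v (f k) x| <= K * `|v|.
  apply: filter_forall => k; apply: (near_derive_bounded (ltW r0) BD).
  exact/classC21/f_C2.
have bt : \forall K \near +oo%R, forall k x y, B x -> B y ->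
    `|f k x - f k y - 'D_(x - y) (f k) y| <= K * `|x - y| ^+ 2.
  apply: filter_forall => k; apply: (near_ball_taylor (ltW r0) BD) => //.
  exact: mean_value_space_col.
have bp := near_ball_taylor (ltW r0) BD (@mean_value_space_real R) P_C2.
have bg := near_ball_grad.
near (pinfty_nbhs R) => K; exists K; split.
- by near: K; exact: nbhs_pinfty_ge.
- by near: K.
- by near: K.
- by near: K.
- by near: K.
- by near: K.
- by near: K.
- move=> x Bx; apply: le_trans (feedback_norm_le P gamma (MFP 0 x (lexx 0) Bx)) _.
  by rewrite ler_wpM2r//; near: K; exact: nbhs_pinfty_ge.
Unshelve. all: by end_near. Qed.

End ClosedLoop.

(** * Retraction onto the ball *)

Section BallProjection.
Context {R : realType} (n : nat) (c : 'cV[R]_n) (r : R).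
Hypothesis r0 : 0 <= r.

Lemma clamp_dist_le (p q s t : R) :
  `|Num.max p (Num.min q s) - Num.max p (Num.min q t)| <= `|s - t|.
Proof.
have maxP (u v : R) : `|Num.max p u - Num.max p v| <= `|u - v|.
  rewrite ler_norml; have := ler_norm (u - v); have := ler_norm (v - u).
  rewrite (distrC v); case: (leP p u) => h1; case: (leP p v) => h2;
  by move=> h3 h4; apply/andP; split; lra.
apply: le_trans (maxP _ _) _.
rewrite ler_norml; have := ler_norm (s - t); have := ler_norm (t - s).
rewrite (distrC t); case: (leP q s) => h1; case: (leP q t) => h2;
by move=> h3 h4; apply/andP; split; lra.
Qed.

(** The sup-norm ball is a cube, so clamping each coordinate is a nonexpansive retraction onto
    it. *)
Definition ball_proj (x : 'cV[R]_n) : 'cV[R]_n :=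
  \col_i Num.max (c i 0 - r) (Num.min (c i 0 + r) (x i 0)).

Lemma ball_proj_in x : `|ball_proj x - c| <= r.
Proof.
apply: norm_le_coord => // i; rewrite !mxE ler_distl le_max lexx/=.
by rewrite ge_max ge_min lexx/= andbT lerD2l ge0_cp.
Qed.

Lemma ball_proj_id x : `|x - c| <= r -> ball_proj x = x.
Proof.
move=> xr; apply/colP => i; rewrite mxE.
have := le_trans (coord_le_norm (x - c) i 0) xr.
rewrite !mxE ler_distl => /andP[h1 h2].
by rewrite min_r// max_r.
Qed.

Lemma ball_proj_lip x y : `|ball_proj x - ball_proj y| <= `|x - y|.
Proof.
apply: norm_le_coord => // i; rewrite !mxE.
have := coord_le_norm (x - y) i 0; rewrite !mxE; apply: le_trans.
exact: clamp_dist_le.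
Qed.

Lemma ball_proj_continuous : continuous ball_proj.
Proof.
move=> x; apply: continuous_col => i.
rewrite (_ : (fun y => _) =
  (fun y : 'cV[R]_n => Num.max (c i 0 - r) (Num.min (c i 0 + r) (y i 0)))); last first.
  by apply/funext => y; rewrite mxE.
apply: continuous_max; first exact: cst_continuous.
by apply: continuous_min; [exact: cst_continuous|exact: coord_continuous].
Qed.
End BallProjection.

(** * Existence, expansion and decrease of P over one sampling period *)

Section Period.
Context {R : realType} (n m : nat) (D : set 'cV[R]_n).
Variables (f : 'I_m -> 'cV[R]_n -> 'cV[R]_n).
Variables (S1 : {set 'I_m}) (S2 : {set 'I_m * 'I_m}).
Hypothesis hn : (#|S1| + #|S2|)%N = n.
Variables (kappa : 'I_m * 'I_m -> nat) (xs : 'cV[R]_n) (P : 'cV[R]_n -> R).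
Variables (gamma r K : R).
Hypothesis r0 : 0 < r.
Let B := [set x : 'cV[R]_n | `|x - xs| <= r].
Hypothesis BD : B `<=` D.
Hypothesis f_C2 : forall k, classC 2 D (f k).
Hypothesis f_span : forall x, D x -> spanning f S1 S2 x.
Hypothesis kappa_gt0 : forall j, j \in S2 -> (0 < kappa j)%N.
Hypothesis kappa_inj : {in S2 &, injective kappa}.
Hypothesis P_C2 : classC 2 D (P : 'cV[R]_n -> R^o).
Hypothesis gamma0 : 0 < gamma.
Hypothesis est : ball_estimates f hn xs P gamma r K.

Let fb := feedback f hn P gamma.
(** The summand n bounds the drift, the other one the oscillations. *)
Definition control_const : R := n%:R + osc_bound S2 kappa.
Let C := control_const.
(* The constant of [period_expansion]. *)
Definition remainder_const : R :=
  m%:R * (2 * m%:R ^+ 2 * K ^+ 3 * C ^+ 3 + 2 * m%:R * C ^+ 2 * K ^+ 2).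
(* Order of magnitude of the displacement during a period starting at y. *)
Definition excursion eps y : R := Num.sqrt (eps * `|fb y|).

(** [small_excursion] lets h^2 be bounded by h; [small_displacement] keeps in the ball what starts
    in the half ball; [small_contraction] is the condition of the Picard iteration; the last two
    fields each allow a quarter of gamma to be lost in the decrease of P. *)
Record small_period (eps : R) : Prop := SmallPeriod {
  small_gt0 : 0 < eps;
  small_excursion : forall y, B y -> excursion eps y <= 1;
  small_displacement : forall y, B y -> m%:R * K * C * excursion eps y < r / 2;
  small_contraction : forall y, B y -> m%:R * K * C * excursion eps y <= 2^-1;
  small_remainder : forall y, B y ->
    n%:R * (remainder_const * K * excursion eps y) <= gamma / 4;
  small_quadratic : K * eps * (gamma + remainder_const * K) ^+ 2 <= gamma / 4 }.

Lemma control_const_ge0 : 0 <= C.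
Proof. by rewrite addr_ge0// osc_bound_ge0. Qed.

Lemma remainder_const_ge0 : 0 <= remainder_const.
Proof.
have K0 := ball_ge0 est; have C0 := control_const_ge0.
rewrite /remainder_const; apply: mulr_ge0 => //; apply: addr_ge0.
  by rewrite !mulr_ge0// exprn_ge0.
by rewrite !mulr_ge0// exprn_ge0.
Qed.

Lemma ex_small_period : exists2 eps_bar : R, 0 < eps_bar &
  forall eps, 0 < eps -> eps < eps_bar -> small_period eps.
Proof.
have K0 := ball_ge0 est; have C0 := control_const_ge0.
have C40 := remainder_const_ge0.
(* All conditions linear in the excursion are merged into one: L adds up their coefficients and d is
   the smallest of their bounds. On the ball the excursion is at most sqrt(eps K^2 r), which gives
   the first bound on eps. *)
pose L := m%:R * K * C + n%:R * (remainder_const * K) + 1.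
have mKC0 : 0 <= m%:R * K * C.
  by apply: mulr_ge0 => //; apply: mulr_ge0.
have nC0 : 0 <= n%:R * (remainder_const * K).
  by apply: mulr_ge0 => //; apply: mulr_ge0.
have L0 : 0 < L by rewrite ltr_wpDl// addr_ge0.
pose d : R := Num.min 1 (Num.min 2^-1 (Num.min (r / 2) (gamma / 4))).
have d0 : 0 < d by rewrite !lt_min ltr01 invr_gt0 ltr0n !divr_gt0.
have /and4P[d1 d2 d3 d4] : [&& d <= 1, d <= 2^-1, d <= r / 2 & d <= gamma / 4].
  by rewrite /d !ge_min !lexx /= ?orbT.
pose s := d / L.
have s0 : 0 < s by exact: divr_gt0.
pose Q := K * (gamma + remainder_const * K) ^+ 2.
have M0 : 0 <= K * (K * r) by rewrite !mulr_ge0// ltW.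
have Q0 : 0 <= Q by rewrite mulr_ge0// sqr_ge0.
exists (Num.min (s ^+ 2 / (K * (K * r) + 1)) (gamma / 4 / (Q + 1))).
  by rewrite lt_min !divr_gt0 ?exprn_gt0 ?ltr_wpDl.
move=> eps e0; rewrite lt_min => /andP[e1 e2].
have sz y : B y -> excursion eps y <= s.
  move=> By; rewrite -[leRHS]gtr0_norm// -sqrtr_sqr ler_wsqrtr//.
  apply: (@le_trans _ _ (eps * (K * (K * r)))).
    rewrite ler_wpM2l ?(ltW e0)// (le_trans (ball_feedback est By))// ler_wpM2l//.
    by rewrite (le_trans (ball_grad est By))// ler_wpM2l.
  move: e1; rewrite ltr_pdivlMr ?ltr_wpDl// => /ltW; apply: le_trans.
  by rewrite ler_wpM2l ?(ltW e0)// lerDl.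
have sL y : B y -> L * excursion eps y <= d.
  by move=> By; rewrite mulrC -ler_pdivlMr// sz.
have sz0 y : 0 <= excursion eps y by exact: sqrtr_ge0.
have LE y : L * excursion eps y = m%:R * K * C * excursion eps y +
    n%:R * (remainder_const * K * excursion eps y) + excursion eps y by rewrite /L; ring.
have p1 y : 0 <= m%:R * K * C * excursion eps y by apply: mulr_ge0.
have p2 y : 0 <= n%:R * (remainder_const * K * excursion eps y).
  by apply: mulr_ge0 => //; apply: mulr_ge0 => //; apply: mulr_ge0.
split => //.
- by move=> y /sL; rewrite LE; have := p1 y; have := p2 y; lra.
- move=> y By; have := sL y By; rewrite LE; have := p1 y; have := p2 y.
  (* Strictness comes from the extra summand [excursion eps y], or, if that vanishes, from r > 0. *)
  have [h0|h0] := leP (excursion eps y) 0; last by lra.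
  have -> : excursion eps y = 0 by apply/eqP; rewrite eq_le h0 sz0.
  by rewrite !mulr0 => *; rewrite divr_gt0.
- by move=> y /sL; rewrite LE; have := p2 y; have := sz0 y; lra.
- by move=> y /sL; rewrite LE; have := p1 y; have := sz0 y; lra.
- move: e2; rewrite ltr_pdivlMr ?ltr_wpDl// => /ltW; apply: le_trans.
  by rewrite mulrAC -/Q mulrC ler_wpM2l ?(ltW e0)// lerDl.
Qed.

Section Fixed.
Variable eps : R.
Hypothesis small : small_period eps.
Let eps0 := small_gt0 small.

Definition rhs y t x : 'cV[R]_n := \sum_k control hn kappa eps (fb y) k t *: f k x.

Let excursion_sqr y : excursion eps y ^+ 2 = eps * `|fb y|.
Proof. by rewrite sqr_sqrtr// mulr_ge0// ltW. Qed.

Let excursion_ge0 y : 0 <= excursion eps y. Proof. exact: sqrtr_ge0. Qed.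

Lemma drift_excursion_le y k : `|drift hn (fb y) k| <= C * excursion eps y ^+ 2 / eps.
Proof.
rewrite excursion_sqr (le_trans (drift_le _ _ _))//.
rewrite [leRHS](_ : _ = C * `|fb y|); last by field; rewrite gt_eqF.
by rewrite ler_wpM2r// lerDl osc_bound_ge0.
Qed.

Let osc_bound_excursion_le y k t :
  `|osc hn kappa eps (fb y) k t| <= osc_bound S2 kappa * excursion eps y / eps.
Proof.
rewrite (le_trans (osc_le _ _ _ _ _ _))// -mulrA ler_wpM2l ?osc_bound_ge0//.
rewrite /excursion sqrtrM ?(ltW eps0)// le_eqVlt; apply/orP; left; apply/eqP.
have e0 : Num.sqrt eps != 0 by rewrite gt_eqF// sqrtr_gt0.
by rewrite -{3}(sqr_sqrtr (ltW eps0)); field.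
Qed.

Lemma osc_excursion_le y k t :
  `|osc hn kappa eps (fb y) k t| <= C * excursion eps y / eps.
Proof.
rewrite (le_trans (osc_bound_excursion_le _ _ _))// ler_wpM2r ?invr_ge0 ?(ltW eps0)//.
by rewrite ler_wpM2r// lerDr.
Qed.

(** The drift is n h^2 / eps; since h is at most 1, it is absorbed in the order h / eps of the
    oscillations. *)
Lemma control_excursion_le y k t : B y ->
  `|drift hn (fb y) k + osc hn kappa eps (fb y) k t| <= C * excursion eps y / eps.
Proof.
move=> By; rewrite (le_trans (ler_normD _ _))//.
rewrite [leRHS](_ : _ = n%:R * excursion eps y / eps +
  osc_bound S2 kappa * excursion eps y / eps);
  last by rewrite /C /control_const; ring.
rewrite lerD// (le_trans (drift_le _ _ _))// -mulrA ler_wpM2l//.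
rewrite ler_pdivlMr// mulrC -excursion_sqr expr2 -[leRHS]mulr1 ler_wpM2l//.
exact: small_excursion.
Qed.

Lemma rhsE y t x : rhs y t x =
  \sum_k (drift hn (fb y) k + osc hn kappa eps (fb y) k t) *: f k x.
Proof. by apply: eq_bigr => k _; rewrite control_split. Qed.

Let half_B y : `|y - xs| <= r / 2 -> B y.
Proof. by move=> h; apply: (le_trans h); have := r0; lra. Qed.

Lemma rhs_le y t x : B y -> B x -> `|rhs y t x| <= m%:R * (C * excursion eps y / eps * K).
Proof.
move=> By Bx; rewrite rhsE; apply: sum_norm_le => k; rewrite normrZ ler_pM//.
  exact: control_excursion_le.
exact: ball_f est _ _ Bx.
Qed.

Lemma rhs_lip y t x x' : B y -> B x -> B x' ->
  `|rhs y t x - rhs y t x'| <= m%:R * (C * excursion eps y / eps * (K * `|x - x'|)).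
Proof.
move=> By Bx Bx'; rewrite !rhsE -sumrB; apply: sum_norm_le => k.
rewrite -scalerBr normrZ ler_pM//; first exact: control_excursion_le.
exact: ball_f_lip est _ _ _ Bx Bx'.
Qed.

Let f_differentiable k x : B x -> differentiable (f k) x.
Proof. by move=> Bx; case: (f_C2 k) => + _; apply; exact: BD. Qed.

Let P_differentiable x : B x -> differentiable (P : 'cV[R]_n -> R^o) x.
Proof. by move=> Bx; case: P_C2 => + _; apply; exact: BD. Qed.

Section Solution.
Variables (a : R) (y : 'cV[R]_n) (x : R -> 'cV[R]_n).
Hypothesis y_half : `|y - xs| <= r / 2.
Hypothesis xa : x a = y.
Hypothesis x_prim : primitive_on a (a + eps) x (fun t => rhs y t (x t)).

Let By : B y := half_B y_half.

Let x_prim' : primitive_on a (a + eps) x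
  (fun t => \sum_k (drift hn (fb y) k + osc hn kappa eps (fb y) k t) *: f k (x t)).
Proof.
by rewrite (_ : (fun t => _) = (fun t => rhs y t (x t)))//; apply/funext => t; rewrite rhsE.
Qed.

Let xa_ball : `|x a - xs| + r / 2 <= r.
Proof. by rewrite xa; have := y_half; lra. Qed.

Lemma solution_ball t : a <= t <= a + eps -> B (x t).
Proof.
exact: (period_ball (ball_ge0 est) control_const_ge0 (ball_f est) eps0 (excursion_ge0 y)
  (fun k t => control_excursion_le k t By) x_prim' (small_displacement small By) xa_ball).
Qed.

Lemma solution_displacement t : a <= t <= a + eps ->
  `|x t - y| <= m%:R * K * C * excursion eps y.
Proof.
move=> tab; rewrite -[X in _ - X]xa.
exact: (period_displacement (ball_ge0 est) control_const_ge0 (ball_f est) eps0 (excursion_ge0 y)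
  (fun k t => control_excursion_le k t By) x_prim' (small_displacement small By) xa_ball tab).
Qed.

(** The averaged motion is eps times the frame applied to the feedback, that is - eps gamma grad
    P(y). In the remainder, h^3 is split as h times eps |a(y)|, and [ball_feedback] turns |a(y)|
    into K |grad P(y)|. *)
Lemma solution_expansion : `|x (a + eps) - y + (eps * gamma) *: grad P y| <=
  remainder_const * K * excursion eps y * (eps * `|grad P y|).
Proof.
have K0 := ball_ge0 est.
have := period_expansion K0 control_const_ge0 f_differentiable (ball_f est)
  (ball_f_lip est) (ball_df est) (ball_f_taylor est) eps0 (excursion_ge0 y)
  (drift_excursion_le y) (osc_excursion_le y) (fun k t => control_excursion_le k t By)
  (is_derive_osc_primitive hn kappa_gt0 eps0 (fb y))
  (osc_primitive_period hn kappa eps0 (fb y))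
  (osc_period_primitive hn kappa_gt0 kappa_inj eps0 (fb y))
  x_prim' (small_displacement small By) xa_ball.
rewrite xa.
have -> : \sum_k \sum_l (eps * \sum_(c < #|S2|) coef2 hn (fb y) c *
      ((k == (enum_val c).2)%:R * (l == (enum_val c).1)%:R -
       (k == (enum_val c).1)%:R * (l == (enum_val c).2)%:R)) *: 'D_(f l y) (f k) y =
    eps *: \sum_(c < #|S2|) coef2 hn (fb y) c *:
      lie_bracket (f (enum_val c).1) (f (enum_val c).2) y.
  rewrite -sum_bracket; last by move=> k; exact: f_differentiable.
  rewrite scaler_sumr; apply: eq_bigr => k _; rewrite scaler_sumr.
  by apply: eq_bigr => l _; rewrite scalerA.
rewrite sum_drift -addrA -opprD -scalerDr -frame_mulmx.
rewrite frame_feedback; last exact/f_span/BD.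
rewrite scalerA mulrN scaleNr opprK => H; apply: (le_trans H).
rewrite -/C -/remainder_const.
rewrite (_ : excursion eps y ^+ 3 = excursion eps y * excursion eps y ^+ 2);
  last by rewrite -exprS.
rewrite excursion_sqr.
have R0 := remainder_const_ge0.
rewrite [leRHS](_ : _ = remainder_const * (excursion eps y * (eps * (K * `|grad P y|))));
  last by ring.
rewrite !ler_wpM2l ?(ltW eps0)//.
exact: ball_feedback est _ By.
Qed.

(** Taylor expansion of P at y: the main increment contributes at most - eps gamma |grad P|^2, while
    the remainder z of the motion and the quadratic term of P each cost at most a quarter of eps
    gamma |grad P|^2. *)
Lemma solution_decrease :
  P (x (a + eps)) <= P y - eps * (gamma / 2) * `|grad P y| ^+ 2.
Proof.
have K0 := ball_ge0 est.
have Bx : B (x (a + eps)) by apply: solution_ball; rewrite lexx lerDl ltW.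
set g := grad P y; set N := `|g|.
pose z := x (a + eps) - y + (eps * gamma) *: g.
pose s := remainder_const * K * excursion eps y.
have s0 : 0 <= s by apply: mulr_ge0 => //; apply: mulr_ge0 => //; exact: remainder_const_ge0.
have zle : `|z| <= s * (eps * N) by exact: solution_expansion.
have dE : x (a + eps) - y = z - (eps * gamma) *: g by rewrite /z addrK.
have N0 : 0 <= N by exact: normr_ge0.
have eN0 : 0 <= eps * N by rewrite mulr_ge0// ltW.
have dle : `|x (a + eps) - y| <= (gamma + s) * (eps * N).
  rewrite dE (le_trans (ler_normB _ _))// normrZ gtr0_norm ?mulr_gt0//.
  by rewrite (_ : (gamma + s) * _ = s * (eps * N) + eps * gamma * N) ?lerD//; ring.
have T := ball_P_taylor est Bx By.
have DE : 'D_(x (a + eps) - y) (P : 'cV[R]_n -> R^o) y =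
    \sum_j z j 0 * g j 0 - eps * gamma * \sum_j g j 0 ^+ 2.
  rewrite derive_coords; last exact: P_differentiable.
  rewrite mulr_sumr -sumrB; apply: eq_bigr => j _.
  rewrite -[LHS]/((x (a + eps) - y) j 0 *
    'D_(delta_mx j 0 : 'cV[R]_n) (P : 'cV[R]_n -> R^o) y).
  rewrite (_ : 'D_(delta_mx j 0 : 'cV[R]_n) (P : 'cV[R]_n -> R^o) y = g j 0);
    last by rewrite mxE.
  by rewrite dE !mxE; ring.
have zg : \sum_j z j 0 * g j 0 <= n%:R * N * (s * (eps * N)).
  apply: le_trans (ler_norm _) _.
  apply: le_trans (_ : _ <= n%:R * N * `|z|) _; last by rewrite ler_wpM2l// mulr_ge0.
  apply: (@sum_coords_le R n R^o z (fun j => g j 0) N) => j.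
  exact: coord_le_norm.
(* The sup norm lies below the Euclidean norm, which is the favourable direction for the
   decrease. *)
have gg : N ^+ 2 <= \sum_j g j 0 ^+ 2.
  have := norm_le_enorm g; rewrite -ler_sqr ?nnegrE ?enorm_ge0// sqr_sqrtr//.
  by apply: sumr_ge0 => j _; exact: sqr_ge0.
have q2 : K * `|x (a + eps) - y| ^+ 2 <= K * ((gamma + s) * (eps * N)) ^+ 2.
  by rewrite ler_wpM2l// ler_sqr ?nnegrE// mulr_ge0// addr_ge0// ltW.
have q3 : K * ((gamma + s) * (eps * N)) ^+ 2 <= gamma / 4 * (eps * N ^+ 2).
  rewrite [leLHS](_ : _ = K * eps * (gamma + s) ^+ 2 * (eps * N ^+ 2)); last by ring.
  rewrite ler_wpM2r ?mulr_ge0 ?(ltW eps0)// (le_trans _ (small_quadratic small))//.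
  rewrite ler_wpM2l ?mulr_ge0 ?(ltW eps0)// ler_sqr ?nnegrE ?addr_ge0 ?(ltW gamma0)//.
    rewrite lerD2l /s -[leRHS]mulr1 ler_wpM2l//; last exact: small_excursion.
    by apply: mulr_ge0 => //; exact: remainder_const_ge0.
  by apply: mulr_ge0 => //; exact: remainder_const_ge0.
have q4 : n%:R * N * (s * (eps * N)) <= gamma / 4 * (eps * N ^+ 2).
  rewrite [leLHS](_ : _ = n%:R * s * (eps * N ^+ 2)); last by ring.
  by rewrite ler_wpM2r ?mulr_ge0 ?(ltW eps0)//; exact: small_remainder.
have q5 : eps * gamma * N ^+ 2 <= eps * gamma * \sum_j g j 0 ^+ 2.
  by rewrite ler_wpM2l// mulr_ge0// ltW.
move: T; rewrite DE => /(le_trans (ler_norm _)) T.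
rewrite (_ : eps * (gamma / 2) * N ^+ 2 = gamma / 4 * (eps * N ^+ 2) * 2); last by field.
rewrite (_ : eps * gamma * N ^+ 2 = gamma / 4 * (eps * N ^+ 2) * 4) in q5; last by field.
move: T q2 q3 q4 q5 zg; move: (gamma / 4 * (eps * N ^+ 2)) => Y.
move: (\sum_j z j 0 * g j 0) (eps * gamma * _) (K * `|_| ^+ 2) (K * _ ^+ 2) (n%:R * N * _).
move: (P (x _)) (P y) => p1 p2 q1 q2 q3 q4 q5; lra.
Qed.
End Solution.

(* The field is precomposed with the projection onto the ball, which makes it
   globally Lipschitz; the solution never leaves the ball. *)
Lemma ex_period_solution a y : `|y - xs| <= r / 2 ->
  exists X : R -> 'cV[R]_n, X a = y /\
    forall t, a <= t <= a + eps -> is_derive t 1 X (rhs y t (X t)).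
Proof.
move=> yr; have By := half_B yr; have K0 := ball_ge0 est.
have C0 := control_const_ge0; have s0 := excursion_ge0 y.
have aeps : a <= a + eps by rewrite lerDl ltW.
pose L := m%:R * (C * excursion eps y / eps * K).
have L0 : 0 <= L.
  by do 3! [apply: mulr_ge0 => //]; [exact: mulr_ge0|rewrite invr_ge0 ltW].
have LE : L * (a + eps - a) = m%:R * K * C * excursion eps y.
  by rewrite addrAC subrr add0r /L; field; rewrite gt_eqF.
have pB z : B (ball_proj xs r z) by exact/ball_proj_in/ltW.
have [|||||X [Xa Xd]] := @picard_lindelof R n a (a + eps) aeps
  (fun t z => rhs y t (ball_proj xs r z)) y L L.
- move=> Y Yc t; apply: cvg_big => [|k _]; first exact: add_continuous.
  have cc : {for t, continuous (control hn kappa eps (fb y) k)}.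
    rewrite (_ : control _ _ _ _ _ =
      cst (drift hn (fb y) k) + osc hn kappa eps (fb y) k); last first.
      by apply/funext => u; rewrite control_split.
    by apply: continuousD; [exact: cst_continuous|exact: osc_continuous].
  apply: (cvgZ cc).
  have fc : {for ball_proj xs r (Y t), continuous (f k)}.
    by apply: differentiable_continuous; exact: f_differentiable.
  have pc : {for t, continuous (ball_proj xs r \o Y)}.
    by apply: continuous_comp; [exact: Yc|exact: ball_proj_continuous].
  exact: (@continuous_comp _ _ _ (ball_proj xs r \o Y) (f k) t pc fc).
- move=> t z z' _; apply: le_trans (rhs_lip t By (pB z) (pB z')) _.
  rewrite [leRHS](_ : _ = m%:R * (C * excursion eps y / eps * (K * `|z - z'|)));
    last by rewrite /L; ring.
  have Ce : 0 <= C * excursion eps y / eps.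
    by apply: mulr_ge0; [exact: mulr_ge0|rewrite invr_ge0 ltW].
  apply: ler_wpM2l => //; apply: ler_wpM2l => //; apply: ler_wpM2l => //.
  exact: ball_proj_lip.
- by move=> t z _; exact: rhs_le.
- exact: L0.
- by rewrite LE small_contraction.
have Xp : primitive_on a (a + eps) X (fun t => rhs y t (ball_proj xs r (X t))).
  move=> i; split; last first.
    by move=> t; rewrite in_itv/= => /andP[a1 a2]; apply: Xd; rewrite !ltW.
  apply: derivable_within_continuous => t; rewrite in_itv/= => tab.
  by case: (Xd t i tab).
(* The projected field is bounded everywhere, so the displacement is bounded before it is known that
   X stays in the ball. *)
have XB t : a <= t <= a + eps -> B (X t).
  move=> /andP[at_ tb].
  have := mean_value_col at_ L0 (primitive_on_sub (lexx a) tb Xp).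
  rewrite Xa => H.
  have {}H : `|X t - y| <= L * (t - a) by apply: H => s _; exact: rhs_le.
  have h2 : L * (t - a) <= L * (a + eps - a) by rewrite ler_wpM2l// lerB.
  have := small_displacement small By; rewrite -LE => h3.
  rewrite /B /= -(subrKA y) (le_trans (ler_normD _ _))//.
  by move: H h2 h3 yr; lra.
exists X; split => // t tab; apply: is_derive_cols => i.
by have := Xd t i tab; rewrite ball_proj_id//; exact: XB.
Qed.

End Fixed.
End Period.

(** * Lyapunov argument *)

Section Grid.
Context {R : realType} (eps t0 : R).
Hypothesis eps0 : 0 < eps.

Lemma ex_period_index (J : nat) t : t0 + eps * J%:R <= t ->
  exists2 k, (J <= k)%N & t0 + eps * k%:R <= t < t0 + eps * k.+1%:R.
Proof.
move=> Jt; have q0 : 0 <= (t - t0) / eps.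
  rewrite divr_ge0 ?(ltW eps0)// subr_ge0 (le_trans _ Jt)// lerDl mulr_ge0//.
  exact: ltW.
have /andP[k1 k2] := truncn_itv q0.
rewrite ler_pdivlMr// lerBrDl mulrC in k1.
rewrite ltr_pdivrMr// ltrBlDl mulrC in k2.
exists (Num.truncn ((t - t0) / eps)); last by rewrite k1 k2.
have := le_lt_trans Jt k2; rewrite ltrD2l ltr_pM2l// ltr_nat ltnS.
by [].
Qed.

Lemma period_index_unique j t : t0 + eps * j%:R <= t < t0 + eps * j.+1%:R ->
  Num.truncn ((t - t0) / eps) = j.
Proof.
move=> /andP[t1 t2]; apply/eqP; rewrite truncn_eq; last first.
  by rewrite divr_ge0 ?(ltW eps0)// subr_ge0 (le_trans _ t1)// lerDl mulr_ge0// ltW.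
rewrite ler_pdivlMr// ltr_pdivrMr// lerBrDl ltrBlDl mulrC t1/=.
by rewrite mulrC.
Qed.

Lemma period_end j : t0 + eps * j%:R + eps = t0 + eps * j.+1%:R.
Proof. by rewrite -natr1 mulrDr mulr1 addrA. Qed.

Lemma lipschitz_glue (V : normedModType R) (x : R -> V) L :
  (forall j s t, t0 + eps * j%:R <= s -> s <= t -> t <= t0 + eps * j.+1%:R ->
     `|x t - x s| <= L * (t - s)) ->
  forall s t, t0 <= s -> s <= t -> `|x t - x s| <= L * (t - s).
Proof.
move=> xL.
have H j : forall s t, t0 <= s -> s <= t -> t <= t0 + eps * j%:R ->
    `|x t - x s| <= L * (t - s).
  elim: j => [|j ih] s t s0 st tj.
    rewrite mulr0 addr0 in tj.
    have -> : t = s by apply/eqP; rewrite eq_le st (le_trans tj).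
    by rewrite !subrr normr0 mulr0.
  have [tj'|/ltW tj'] := leP t (t0 + eps * j%:R); first exact: ih.
  have [sj|/ltW sj] := leP (t0 + eps * j%:R) s; first exact: (xL j).
  rewrite -(subrKA (x (t0 + eps * j%:R))) (le_trans (ler_normD _ _))//.
  have h1 := xL j _ _ (lexx _) tj' tj.
  have h2 := ih _ _ s0 sj (lexx _).
  by rewrite (le_trans (lerD h1 h2))// -mulrDr subrKA.
move=> s t s0 st.
have [|k _ /andP[_ /ltW tk]] := @ex_period_index 0 t.
  by rewrite mulr0 addr0 (le_trans s0).
exact: H st tk.
Qed.
End Grid.

Section Lyapunov.
Context {R : realType} (n m : nat) (D : set 'cV[R]_n).
Variables (f : 'I_m -> 'cV[R]_n -> 'cV[R]_n).
Variables (S1 : {set 'I_m}) (S2 : {set 'I_m * 'I_m}).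
Hypothesis hn : (#|S1| + #|S2|)%N = n.
Variables (kappa : 'I_m * 'I_m -> nat) (xs : 'cV[R]_n) (P : 'cV[R]_n -> R).
Variables (gamma r K mP : R).
Hypothesis r0 : 0 < r.
Let B := [set x : 'cV[R]_n | `|x - xs| <= r].
Hypothesis BD : B `<=` D.
Hypothesis f_C2 : forall k, classC 2 D (f k).
Hypothesis f_span : forall x, D x -> spanning f S1 S2 x.
Hypothesis kappa_gt0 : forall j, j \in S2 -> (0 < kappa j)%N.
Hypothesis kappa_inj : {in S2 &, injective kappa}.
Hypothesis P_C2 : classC 2 D (P : 'cV[R]_n -> R^o).
Hypothesis gamma0 : 0 < gamma.
Hypothesis est : ball_estimates f hn xs P gamma r K.
Variables (w11 w12 : R -> R).
Hypotheses (w11K : classK w11) (w12K : classK w12).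
Hypothesis P_bounds : forall x, D x ->
  w11 (enorm (x - xs)) <= P x - mP <= w12 (enorm (x - xs)).
Hypothesis P_crit : forall x, D x -> enorm (grad P x) = 0 <-> x = xs.

(** With delta such that w12 < w11(rho) up to delta, a point at distance at least rho would have a
    larger value of P than any point within delta. *)
Lemma level_set_bound rho : 0 < rho -> exists2 delta : R, 0 < delta &
  forall x y, D x -> D y -> enorm (y - xs) <= delta -> P x <= P y ->
    enorm (x - xs) < rho.
Proof.
move=> rho0; have [c12 m12 _ w120] := w12K; have [_ m11 _ w110] := w11K.
have w0 : 0 < w11 rho by rewrite -w110; apply: m11 => //; rewrite in_itv/= ?lexx ?(ltW rho0).
have c01 : {within `[0, 1], continuous (w12 : R -> R^o)}.
  by apply: continuous_subspaceW c12; apply: subset_itv; rewrite bnd_simp.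
have [|d d0 dP] := within_itv_continuousP (t := 0) c01 _ w0; first by rewrite lexx ler01.
(* The bound 1 stays inside the segment on which continuity of [w12] at 0 is used; halving d makes
   the inequality strict. *)
exists (Num.min 1 (d / 2)) => [|x y Dx Dy]; first by rewrite lt_min ltr01 divr_gt0.
rewrite le_min => /andP[y1 yd] Pxy.
rewrite ltNge; apply/negP => rx.
have : w12 (enorm (y - xs)) < w11 rho.
  have := dP (enorm (y - xs)); rewrite w120 !sub0r !normrN enorm_ge0 y1.
  rewrite (ger0_norm (enorm_ge0 _)) => H; apply: le_lt_trans (ler_norm _) (H isT _).
  by apply: le_lt_trans yd _; rewrite ltr_pdivrMr// ltr_pMr// ltr1n.
have /andP[h1 _] := P_bounds Dx; have /andP[_ h2] := P_bounds Dy.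
have h3 : w11 rho <= w11 (enorm (x - xs)).
  move: rx; rewrite le_eqVlt => /predU1P[<-//|rx]; apply/ltW/m11 => //.
    by rewrite in_itv/= ltW.
  by rewrite in_itv/= enorm_ge0.
by move=> h4; have : P x - mP <= P y - mP := (lerB Pxy (lexx _)); lra.
Qed.

Variable eps : R.
Hypothesis small : small_period f hn kappa xs P gamma r K eps.
Let eps0 := small_gt0 small.
Let fb := feedback f hn P gamma.
Let C : R := control_const n S2 kappa.

Let half_D y : `|y - xs| <= r / 2 -> D y.
Proof. by move=> h; apply/BD/(le_trans h); have := r0; lra. Qed.

Section InitialTime.
Variable t0 : R.
Let tt (j : nat) : R := t0 + eps * j%:R.

(** A relation between consecutive samples: the same arguments then serve a given solution and the
    one being built, before its pieces are glued. *)
Definition period_step j y y' := exists X : R -> 'cV[R]_n,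
  [/\ X (tt j) = y,
      primitive_on (tt j) (tt j + eps) X (fun t => rhs f hn kappa P gamma eps y t (X t)) &
      y' = X (tt j + eps)].

Lemma period_step_decrease j y y' : `|y - xs| <= r / 2 -> period_step j y y' ->
  D y' /\ P y' <= P y - eps * (gamma / 2) * `|grad P y| ^+ 2.
Proof.
move=> yr [X [Xj Xp ->]]; split.
  apply: BD; apply: (solution_ball r0 est small yr Xj Xp).
  by rewrite lexx lerDl ltW.
exact: (solution_decrease r0 BD f_C2 f_span kappa_gt0 kappa_inj P_C2 gamma0 est
  small yr Xj Xp).
Qed.

Section Sequence.
Variable Y : nat -> 'cV[R]_n.
Hypothesis Y_step : forall j, `|Y j - xs| <= r / 2 -> period_step j (Y j) (Y j.+1).

(** The induction carries position and value of P together: the position gives access to the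
    decrease, and the value compared with that at J gives the next position. Starting at an
    arbitrary J allows a restart when the sequence has come close to [xs]. *)
Lemma sequence_stays J rho delta : rho <= r / 2 ->
  (forall x y, D x -> D y -> enorm (y - xs) <= delta -> P x <= P y ->
    enorm (x - xs) < rho) ->
  D (Y J) -> enorm (Y J - xs) <= delta ->
  forall k, enorm (Y (J + k) - xs) < rho.
Proof.
move=> rr level DJ YJ k.
suff : enorm (Y (J + k) - xs) < rho /\ P (Y (J + k)) <= P (Y J) by case.
elim: k => [|k [ih1 ih2]]; first by rewrite addn0; split => //; exact: (level _ (Y J)).
have Yr : `|Y (J + k)%N - xs| <= r / 2.
  by rewrite (le_trans (norm_le_enorm _))// (le_trans (ltW ih1)).
have [DY PY] := period_step_decrease Yr (Y_step Yr).
have PJ : P (Y (J + k.+1)) <= P (Y J).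
  rewrite addnS (le_trans PY)// (le_trans _ ih2)// gerBl.
  by rewrite mulr_ge0 ?sqr_ge0// mulr_ge0 ?divr_ge0// ltW.
by split => //; apply: (level _ (Y J)) => //; rewrite addnS.
Qed.

Let grad_continuous x : D x -> {for x, continuous (fun z => `|grad P z|)}.
Proof.
move=> Dx; suff gc : {for x, continuous (grad P)}.
  exact: (@continuous_comp _ _ _ (grad P) (fun v => `|v|) x gc (@norm_continuous _ _ _)).
apply: continuous_col => i; rewrite (_ : (fun y => _) =
    (fun y => 'D_(delta_mx i 0 : 'cV[R]_n) (P : 'cV[R]_n -> R^o) y)); last first.
  by apply/funext => y; rewrite mxE.
have [_ /(_ (delta_mx i 0))[Pd _]] := P_C2.
exact/differentiable_continuous/Pd.
Qed.

(** The ball minus a neighbourhood of [xs] is compact, and the minimum of the gradient norm there is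
    nonzero by [P_crit]. *)
Lemma grad_bounded_away delta : 0 < delta ->
  exists2 nu : R, 0 < nu & forall x, B x -> delta <= `|x - xs| -> nu <= `|grad P x|.
Proof.
move=> delta0; pose E := B `&` [set x | delta <= `|x - xs|].
have [[y Ey]|E0] := pselect (E !=set0); last first.
  (* The ball has no point that far from [xs], and any positive number will do. *)
  exists 1 => // x Bx dx; exfalso; apply: E0; by exists x.
have Ec : compact E.
  apply: compact_closedI; first exact/compact_sup_ball/ltW.
  apply: (@closed_comp _ _ (fun x : 'cV[R]_n => `|x - xs|) [set s | delta <= s]).
    move=> x _.
    have xc : {for x, continuous (fun z : 'cV[R]_n => z - xs)}.
      exact: (@continuousB _ _ _ id (cst xs) x (@cvg_id _ _) (@cst_continuous _ _ xs x)).
    exact: (@continuous_comp _ _ _ (fun z : 'cV[R]_n => z - xs) (fun v => `|v|) x xc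
      (@norm_continuous _ _ _)).
  exact: closed_ge.
have [||z zE zmin] := @compact_EVT_min _ R (fun x => `|grad P x|) E _ Ec.
- by exists y.
- by apply: continuous_in_subspaceT => x; rewrite inE => -[/BD Dx _]; exact: grad_continuous.
move: zE; rewrite inE => -[Bz dz].
exists `|grad P z| => [|x Bx dx]; last by apply: zmin; rewrite inE.
rewrite lt_neqAle normr_ge0 andbT; apply/negP => /eqP/esym/eqP; rewrite normr_eq0 => /eqP gz.
have zxs : z = xs.
  apply/(P_crit (BD Bz)).1; rewrite gz /enorm big1 ?sqrtr0// => i _.
  by rewrite mxE expr0n.
by move: dz; rewrite zxs /= subrr normr0 leNgt delta0.
Qed.

(** Otherwise the gradient stays away from 0 and P drops by a fixed amount in every period,
    eventually below [mP]. *)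
Lemma sequence_attracted delta delta1 :
  (forall x y, D x -> D y -> enorm (y - xs) <= delta -> P x <= P y ->
    enorm (x - xs) < r / 2) ->
  D (Y 0%N) -> enorm (Y 0%N - xs) <= delta -> 0 < delta1 ->
  exists J, enorm (Y J - xs) <= delta1.
Proof.
move=> level D0 Y0 d10; apply: contrapT => no.
(* Far in the Euclidean norm implies far in the sup norm; n + 1 keeps the denominator positive when
   n = 0. *)
have far J : delta1 / (n%:R + 1) <= `|Y J - xs|.
  rewrite leNgt; apply/negP; rewrite ltr_pdivlMr ?ltr_wpDl// => h; apply: no; exists J.
  rewrite (le_trans (enorm_le_norm _))// (le_trans _ (ltW h))// mulrC.
  by rewrite ler_wpM2l// lerDl.
have near_ k : `|Y k - xs| <= r / 2.
  rewrite (le_trans (norm_le_enorm _))// ltW//.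
  exact: (sequence_stays (J := 0%N) (lexx _) level D0 Y0 k).
have [nu nu0 nuP] := grad_bounded_away (divr_gt0 d10 (ltr_wpDl (ler0n R n) (ltr01))).
pose w := eps * (gamma / 2) * nu ^+ 2.
have w0 : 0 < w by rewrite !mulr_gt0// ?invr_gt0// ?exprn_gt0.
have dec k : P (Y k) <= P (Y 0%N) - w * k%:R.
  elim: k => [|k ih]; first by rewrite mulr0 subr0.
  have [_ h] := period_step_decrease (near_ k) (Y_step (near_ k)).
  have Bk : B (Y k) by apply: le_trans (near_ k) _; have := r0; lra.
  have : w <= eps * (gamma / 2) * `|grad P (Y k)| ^+ 2.
    rewrite ler_wpM2l//; first by rewrite mulr_ge0 ?divr_ge0// ltW.
    by rewrite ler_sqr ?nnegrE ?nuP// ltW.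
  by rewrite -[k.+1%:R]natr1 (mulrDr w) mulr1; move: h ih; lra.
have low k : mP <= P (Y k).
  have /andP[+ _] := P_bounds (half_D (near_ k)).
  have [_ _ w11_ge0 _] := w11K; have := w11_ge0 _ (enorm_ge0 (Y k - xs)).
  by move=> h1 h2; move: (le_trans h1 h2); rewrite subr_ge0.
pose k := (Num.truncn ((P (Y 0%N) - mP) / w)).+1.
have kP : P (Y 0%N) - mP < w * k%:R.
  by rewrite mulrC -ltr_pdivrMr// truncnS_gt.
by have := dec k; have := low k; move: kP; lra.
Qed.

End Sequence.
End InitialTime.

Lemma excursion_sqrt_le y : B y ->
  excursion f hn P gamma eps y <= Num.sqrt eps * K * Num.sqrt `|y - xs|.
Proof.
move=> By; have K0 := ball_ge0 est.
rewrite -[K](ger0_norm K0) -sqrtr_sqr -!sqrtrM ?mulr_ge0 ?sqr_ge0 ?(ltW eps0)//.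
rewrite ler_wsqrtr// -mulrA ler_wpM2l ?(ltW eps0)//.
rewrite (le_trans (ball_feedback est By))// expr2 -mulrA ler_wpM2l//.
exact: ball_grad est _ By.
Qed.

Lemma ex_stay_radius eta : 0 < eta -> exists rho : R, [/\ 0 < rho, rho <= r / 2 &
  forall y z, `|y - xs| <= rho ->
    `|z - y| <= m%:R * K * C * excursion f hn P gamma eps y -> enorm (z - xs) <= eta].
Proof.
move=> eta0; have K0 := ball_ge0 est.
have C0 : 0 <= C by exact: control_const_ge0.
pose A := m%:R * K * C * (Num.sqrt eps * K).
have mKC0 : 0 <= m%:R * K * C by apply: mulr_ge0 => //; apply: mulr_ge0.
have A0 : 0 <= A by apply: mulr_ge0 => //; rewrite mulr_ge0// sqrtr_ge0.
have n1 : 0 < n%:R + 1 :> R by rewrite ltr_wpDl.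
have A1 : 0 < 1 + A by rewrite ltr_wpDr.
(* This q bounds the square root of the distance at the sample. Since q is at most 1, the distance
   is at most q^2, hence q, and the total deviation is at most (1 + A) q. *)
pose q := Num.min 1 (eta / (n%:R + 1) / (1 + A)).
have q0 : 0 < q by rewrite lt_min ltr01 !divr_gt0.
have q1 : q <= 1 by rewrite ge_min lexx.
have q2 : q <= eta / (n%:R + 1) / (1 + A) by rewrite ge_min lexx orbT.
exists (Num.min (r / 2) (q ^+ 2)); split; first by rewrite lt_min divr_gt0// exprn_gt0.
  by rewrite ge_min lexx.
move=> y z; rewrite le_min => /andP[yr yq] zy.
have By : B y by apply: le_trans yr _; have := r0; lra.
have sq : Num.sqrt `|y - xs| <= q.
  by rewrite -[leRHS]gtr0_norm// -sqrtr_sqr ler_wsqrtr.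
have zA : `|z - y| <= A * q.
  apply: (le_trans zy); rewrite [leRHS](_ : _ = m%:R * K * C * (Num.sqrt eps * K * q));
    last by rewrite /A; ring.
  apply: ler_wpM2l => //.
  apply: le_trans (excursion_sqrt_le By) _.
  by rewrite ler_wpM2l// mulr_ge0// sqrtr_ge0.
have yq' : `|y - xs| <= q.
  by rewrite (le_trans yq)// expr2 -[leRHS]mulr1 ler_wpM2l// ltW.
have zq : `|z - xs| <= (1 + A) * q.
  rewrite -(subrKA y) (le_trans (ler_normD _ _))// (le_trans (lerD zA yq'))//.
  by rewrite mulrDl mul1r addrC.
rewrite (le_trans (enorm_le_norm _))//.
move: q2; rewrite ler_pdivlMr// mulrC => /(le_trans zq); rewrite ler_pdivlMr// => h.
by rewrite mulrC (le_trans _ h)// ler_wpM2l// lerDl.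
Qed.

Let half_B y : `|y - xs| <= r / 2 -> B y.
Proof. by move=> h; apply: (le_trans h); have := r0; lra. Qed.

Let sol := pi_solution D f (control hn kappa eps) fb eps.

Lemma pi_solution_step t0 x0 x j : sol t0 x0 x ->
  period_step t0 j (x (t0 + eps * j%:R)) (x (t0 + eps * j.+1%:R)).
Proof.
move=> xsol; exists x; split => //; last by rewrite period_end.
exact: (pi_solution_primitive eps0 xsol).
Qed.

(** Here delta depends neither on the initial time nor on J: J = 0 gives stability, a later J gives
    convergence. *)
Lemma pi_solution_stays eta : 0 < eta -> exists2 delta : R, 0 < delta &
  forall t0 x0 x J, sol t0 x0 x -> enorm (x (t0 + eps * J%:R) - xs) <= delta ->
  forall t, t0 + eps * J%:R <= t -> enorm (x t - xs) <= eta.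
Proof.
move=> eta0; have [rho [rho0 rho_r near_eta]] := ex_stay_radius eta0.
have [delta delta0 level] := level_set_bound rho0.
exists delta => // t0 x0 x J xsol xJ t Jt.
have DJ : D (x (t0 + eps * J%:R)).
  by case: xsol => xD _ _ _; apply: xD; rewrite lerDl mulr_ge0// ltW.
have stays := sequence_stays (Y := fun j => x (t0 + eps * j%:R))
  (fun j _ => pi_solution_step j xsol) rho_r level DJ xJ.
have [k Jk /andP[kt tk]] := ex_period_index eps0 Jt.
have := stays (k - J)%N; rewrite subnKC// => /ltW xk.
have xk_rho := le_trans (norm_le_enorm _) xk.
apply: (near_eta _ _ xk_rho).
apply: (solution_displacement r0 est small (le_trans xk_rho rho_r) erefl).
  exact: (pi_solution_primitive eps0 xsol k).
by rewrite kt period_end ltW.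
Qed.

(** Solutions over a period are chosen for all pairs of index and starting point at once, so that
    the samples follow by plain recursion; that they remain in the half ball is proved afterwards,
    from the decrease of P. *)
Lemma ex_pi_solution delta t0 x0 :
  (forall x y, D x -> D y -> enorm (y - xs) <= delta -> P x <= P y ->
    enorm (x - xs) < r / 2) ->
  D x0 -> enorm (x0 - xs) <= delta -> exists x, sol t0 x0 x.
Proof.
move=> level Dx0 x0d; pose tt (j : nat) := t0 + eps * j%:R.
have /choice[F FP] : forall jy : nat * 'cV[R]_n, exists X : R -> 'cV[R]_n,
    `|jy.2 - xs| <= r / 2 -> X (tt jy.1) = jy.2 /\
      forall t, tt jy.1 <= t <= tt jy.1 + eps ->
        is_derive t 1 X (rhs f hn kappa P gamma eps jy.2 t (X t)).
  (* Outside the half ball a constant function is a placeholder; [Y_half] shows that the samples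
     never reach this case. *)
  move=> [j y] /=; have [yr|yr] := leP `|y - xs| (r / 2); last by exists (fun=> y).
  have [X XP] := ex_period_solution r0 BD f_C2 est small (tt j) yr.
  by exists X.
pose Y := fix Y j := if j is j'.+1 then F (j', Y j') (tt j'.+1) else x0.
have F_prim j : `|Y j - xs| <= r / 2 -> primitive_on (tt j) (tt j + eps) (F (j, Y j))
    (fun t => rhs f hn kappa P gamma eps (Y j) t (F (j, Y j) t)).
  move=> Yj; have [_ Fd] := FP (j, Y j) Yj; move=> i; split.
    apply: derivable_within_continuous => t; rewrite in_itv/= => /Fd Ft.
    by case: (is_derive_coord i Ft).
  move=> t; rewrite in_itv/= => /andP[t1 t2]; apply: is_derive_coord.
  by apply: Fd; rewrite !ltW.
have Y_step j : `|Y j - xs| <= r / 2 -> period_step t0 j (Y j) (Y j.+1).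
  move=> Yj; exists (F (j, Y j)); split; last by rewrite /= period_end.
    by have [] := FP (j, Y j) Yj.
  exact: F_prim.
have Y_half j : `|Y j - xs| <= r / 2.
  rewrite (le_trans (norm_le_enorm _))// ltW//.
  exact: (sequence_stays (J := 0%N) Y_step (lexx _) level Dx0 x0d j).
pose x t := let j := Num.truncn ((t - t0) / eps) in F (j, Y j) t.
have xE j t : tt j <= t < tt j.+1 -> x t = F (j, Y j) t.
  by move=> tj; rewrite /x (period_index_unique eps0 tj).
have ttlt j : tt j < tt j.+1 by rewrite /tt ltrD2l ltr_pM2l// ltr_nat.
have xtt j : x (tt j) = Y j.
  by rewrite (xE j) ?lexx ?ttlt//; have [] := FP (j, Y j) (Y_half j).
(* The right end point belongs to the next piece, which starts at [Y j.+1], the end value of the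
   present one. *)
have xE' j t : tt j <= t <= tt j.+1 -> x t = F (j, Y j) t.
  move=> /andP[t1]; rewrite le_eqVlt => /predU1P[->|t2]; first by rewrite xtt.
  by apply: xE; rewrite t1.
have index t : t0 <= t -> exists j, tt j <= t < tt j.+1.
  move=> t0t; have [|j _ jt] := @ex_period_index _ eps t0 eps0 0 t.
    by rewrite mulr0 addr0.
  by exists j.
have FB j t : tt j <= t <= tt j + eps -> B (F (j, Y j) t).
  move=> jt; have [Fj _] := FP (j, Y j) (Y_half j).
  exact: (solution_ball r0 est small (Y_half j) Fj (F_prim j (Y_half j))).
pose L := m%:R * (C / eps * K).
have K0 := ball_ge0 est; have C0 : 0 <= C by exact: control_const_ge0.
have L0 : 0 <= L.
  by apply: mulr_ge0 => //; apply: mulr_ge0 => //; rewrite divr_ge0// ltW.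
exists x; split.
- move=> t /index[j jt]; rewrite (xE _ _ jt); apply: BD; apply: FB.
  by have /andP[-> /ltW] := jt; rewrite /tt period_end.
- move=> T _; apply: (lipschitz_abs_continuous L0) => s t s0 st _.
  apply: (lipschitz_glue eps0 _ s0 st) => {s t s0 st} j s t js st tj.
  rewrite (xE' j s) ?js ?(le_trans st)// (xE' j t) ?tj ?(le_trans js)//.
  have tj' : t <= tt j + eps by rewrite /tt period_end.
  apply: (mean_value_col st L0 (primitive_on_sub js tj' (F_prim j (Y_half j)))).
  move=> u; rewrite in_itv/= => /andP[su ut].
  have Bu : B (F (j, Y j) u).
    by apply: FB; rewrite (le_trans js (ltW su)) (le_trans (ltW ut)).
  apply: le_trans (rhs_le est small u (half_B (Y_half j)) Bu) _.
  apply: ler_wpM2l => //; apply: ler_wpM2r => //; apply: ler_wpM2r.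
    by rewrite invr_ge0 ltW.
  rewrite -[leRHS]mulr1; apply: ler_wpM2l => //.
  exact: (small_excursion small (half_B (Y_half j))).
- by rewrite -[t0]addr0 -(mulr0 eps) -[0]/(0%:R) -/(tt 0%N) xtt.
- move=> j t /=; rewrite -/(tt j) -/(tt j.+1) => jt.
  have jt' : tt j <= t < tt j.+1 by move: jt; rewrite in_itv.
  rewrite xtt (xE j t jt').
  apply: (@has_deriv_within_eq _ _ _ (F (j, Y j))) => //.
    by move=> s; rewrite /= in_itv/=; exact: xE.
  have [_] := FP (j, Y j) (Y_half j); apply.
  by have /andP[-> /ltW] := jt'; rewrite /tt period_end.
Qed.

(** For convergence, the samples enter any given neighbourhood of [xs] at some J, after which
    [pi_solution_stays] controls all later times, those between samples included. *)
Lemma closed_loop_stable : asymptotically_stable sol xs.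
Proof.
have [Delta Delta0 level] := level_set_bound (divr_gt0 r0 (ltr0n R 2)).
have Dnear : exists2 Delta' : R, 0 < Delta' & forall x0, enorm (x0 - xs) <= Delta' ->
    D x0 /\ enorm (x0 - xs) <= Delta.
  exists (Num.min Delta (r / 2)); first by rewrite lt_min Delta0 divr_gt0.
  move=> x0; rewrite le_min => /andP[h1 h2]; split => //.
  exact/half_D/(le_trans (norm_le_enorm _)).
have [Delta' Delta'0 {}Dnear] := Dnear.
split=> [t0 eta _ eta0|].
  have [delta delta0 stays] := pi_solution_stays eta0.
  exists (Num.min delta Delta') => [|x0]; first by rewrite lt_min delta0.
  rewrite le_min => /andP[xd /Dnear[Dx0 x0D]]; split.
    exact: (ex_pi_solution t0 level Dx0 x0D).
  move=> x xsol t t0t; have [_ _ xt0 _] := xsol.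
  apply: (stays _ _ _ 0%N xsol); rewrite mulr0 addr0//.
  by rewrite xt0.
exists Delta' => // t0 x0 _ /ltW/Dnear[Dx0 x0D]; split.
  exact: (ex_pi_solution t0 level Dx0 x0D).
move=> x xsol; apply/cvgrPdist_le => eta eta0.
have [delta delta0 stays] := pi_solution_stays eta0.
have [_ _ xt0 _] := xsol.
have x0E : x (t0 + eps * 0%:R) = x0 by rewrite mulr0 addr0.
have [J xJ] := sequence_attracted (Y := fun j => x (t0 + eps * j%:R))
  (fun j _ => pi_solution_step j xsol) level
  (eq_ind_r D Dx0 x0E) (eq_ind_r (fun v => enorm (v - xs) <= Delta) x0D x0E) delta0.
have tJ : \forall t \near +oo%R, t0 + eps * J%:R <= t.
  by apply: nbhs_pinfty_ge; exact: num_real.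
apply: filterS tJ => t tJ; rewrite distrC (le_trans (norm_le_enorm _))//.
exact: (stays _ _ _ J xsol).
Qed.
End Lyapunov.

Theorem theorem3 (R : realType) (n m : nat) (D : set 'cV[R]_n)
    (f : 'I_m -> 'cV[R]_n -> 'cV[R]_n)
    (S1 : {set 'I_m}) (S2 : {set 'I_m * 'I_m})
    (hn : (#|S1| + #|S2|)%N = n)
    (kappa : 'I_m * 'I_m -> nat)
    (xs : 'cV[R]_n) (P : 'cV[R]_n -> R) (mP : R)
    (D_open : open D) (D_connected : connected D)
    (f_C2 : forall k, classC 2 D (f k))
    (f_span : forall x, D x -> spanning f S1 S2 x)
    (f_inv_bounded : forall Dt : R -> set 'cV[R]_n,
       (forall t, 0 <= t -> compact (Dt t) /\ Dt t `<=` D) ->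
       exists2 MF : R, 0 < MF &
         forall t x, 0 <= t -> Dt t x -> opnorm (invmx (frame f hn x)) <= MF)
    (kappa_gt0 : forall j, j \in S2 -> (0 < kappa j)%N)
    (kappa_inj : {in S2 &, injective kappa})
    (xs_D : D xs)
    (P_C2 : classC 2 D (P : 'cV[R]_n -> R^o))
    (P_cond1 : exists w11 w12 : R -> R,
       [/\ classK w11, classK w12,
           forall x0, D x0 ->
             exists r : R, [/\ 0 <= r, w11 r = P x0 - mP &
               [set x | enorm (x - xs) <= r] `<=` D] &
           forall x, D x ->
             w11 (enorm (x - xs)) <= P x - mP <= w12 (enorm (x - xs))])
    (P_cond2_zero : forall x, D x -> enorm (grad P x) = 0 <-> x = xs)
    (P_cond2_bound : exists2 w2 : R -> R, classK w2 &
       forall x, D x -> enorm (grad P x) <= w2 (enorm (x - xs))) :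
  forall gamma : R, 0 < gamma ->
  exists2 eps_bar : R, 0 < eps_bar &
  forall eps : R, 0 < eps -> eps < eps_bar ->
    asymptotically_stable
      (pi_solution D f (control hn kappa eps) (feedback f hn P gamma) eps)
      xs.
Proof.
move=> gamma gamma0; have [w11 [w12 [w11K w12K _ P_bounds]]] := P_cond1.
have [r r0 BD] : exists2 r : R, 0 < r & [set x | `|x - xs| <= r] `<=` D.
  have /nbhs_ballP[e /= e0 eD] := open_nbhs_nbhs (conj D_open xs_D).
  exists (e / 2) => [|x /= xe]; first exact: divr_gt0.
  apply: eD; rewrite -ball_normE /= distrC (le_lt_trans xe)//.
  by rewrite ltr_pdivrMr// ltr_pMr// ltr1n.
have grad_xs : grad P xs = 0 by apply/enorm0_eq0/P_cond2_zero.
have [K est] := ex_ball_estimates gamma r0 BD f_C2 f_inv_bounded P_C2 grad_xs.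
have [eps_bar eps_bar0 small] := ex_small_period kappa r0 gamma0 est.
exists eps_bar => // eps eps0 eps_lt.
exact: (closed_loop_stable r0 BD f_C2 f_span kappa_gt0 kappa_inj P_C2 gamma0 est w11K w12K
  P_bounds P_cond2_zero (small _ eps0 eps_lt)).
Qed.
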